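(* Let $\mathbb{PR}$ be a nontrivial projective rectangle with special point $D$. For any three distinct points $d,e,f$ of $\mathbb{PR}$ that lie on a common ordinary line, and for any three distinct collinear points $d,e,f$ of $\mathbb{PR}$ one of which is the special point $D$, the harmonic conjugate of $e$ with respect to $d$ and $f$ exists.
   Context: An incidence structure is a triple $(\mathcal P,\mathcal L,\mathcal I)$ of sets with $\mathcal I\subseteq\mathcal P\times\mathcal L$ (points, lines, incidence). A projective rectangle is an incidence structure such that: (A1) every two distinct points are incident with exactly one line; (A2) there exist four points, no three of them collinear; (A3) every line is incident with at least three distinct points; (A4) there is a special point $D$; a line incident with $D$ is called special, a line not incident with $D$ is called ordinary, and a point other than $D$ is called ordinary; (A5) each special line intersects every other line in exactly one point; (A6) if two ordinary lines $l_1,l_2$ intersect in a point, then every two lines that intersect both $l_1$ and $l_2$ in four distinct points intersect in a point. A projective rectangle is nontrivial if it is not a projective plane. A projective rectangle is regarded as a rank-3 simple matroid whose rank-2 flats are determined by its lines. Harmonic configuration: let $d,e,f$ be three distinct points on a line $l$. Four further points $a_1,a_2,a_3,a_4$, none on $l$ and no three of them collinear, form with $d,e,f$ a harmonic configuration $\mathrm{HP}(d,e,f;a_1,a_2,a_3,a_4)$ based on $(d,e,f)$ if $\{d,a_1,a_2\}$, $\{d,a_4,a_3\}$, $\{e,a_4,a_2\}$, $\{f,a_4,a_1\}$, $\{f,a_3,a_2\}$ are collinear ($\{a_1,e,a_3\}$ may or may not be collinear). The harmonic conjugate of $e$ with respect to $d$ and $f$ exists, and equals $h$, if there is at least one harmonic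 configuration based on $(d,e,f)$, and for every harmonic configuration $\mathrm{HP}(d,e,f;a_1,a_2,a_3,a_4)$ the line through $a_1,a_3$ meets the line $l$ in a point, this point being the same point $h$ for all such configurations ($h=e$ is allowed). *)

(* Defs.v *)
Record incidence_structure : Type := IncidenceStructure {
  point : Type;
  line : Type;
  inc : point -> line -> Prop
}.

Arguments inc {i} _ _.

Section Incidence.

Context {S : incidence_structure}.
Implicit Types (p q a b c d e f h D : point S) (l m s : line S).

Definition collinear a b c : Prop :=
  exists l, inc a l /\ inc b l /\ inc c l.

Definition four_points_no_three_collinear a b c d : Prop :=
  (a <> b /\ a <> c /\ a <> d /\ b <> c /\ b <> d /\ c <> d) /\
  (~ collinear a b c /\ ~ collinear a b d /\
   ~ collinear a c d /\ ~ collinear b c d).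

Definition meet l m : Prop := exists p, inc p l /\ inc p m.

Definition special_line D l : Prop := inc D l.

Definition ordinary_line D l : Prop := ~ inc D l.

(* HP(d,e,f; a1,a2,a3,a4), where l is the line carrying d, e, f. *)
Record harmonic_configuration l d e f
    (a1 a2 a3 a4 : point S) : Prop := HarmonicConfiguration {
  hc_base : inc d l /\ inc e l /\ inc f l;
  hc_base_distinct : d <> e /\ d <> f /\ e <> f;
  hc_off_base : ~ inc a1 l /\ ~ inc a2 l /\ ~ inc a3 l /\ ~ inc a4 l;
  hc_general : four_points_no_three_collinear a1 a2 a3 a4;
  hc_d12 : collinear d a1 a2;
  hc_d43 : collinear d a4 a3;
  hc_e42 : collinear e a4 a2;
  hc_f41 : collinear f a4 a1;
  hc_f32 : collinear f a3 a2
}.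

(* The harmonic conjugate of e with respect to d and f exists and equals h.
   In the last clause m is the line a1 a3. *)
Definition is_harmonic_conjugate d e f h : Prop :=
  exists l,
    (inc d l /\ inc e l /\ inc f l) /\
    (exists a1 a2 a3 a4, harmonic_configuration l d e f a1 a2 a3 a4) /\
    (forall a1 a2 a3 a4, harmonic_configuration l d e f a1 a2 a3 a4 ->
       exists m, inc a1 m /\ inc a3 m /\ inc h m /\ inc h l).

End Incidence.

Record projective_rectangle (S : incidence_structure) (D : point S) : Prop :=
  ProjectiveRectangle {
  pr_A1 : forall p q : point S, p <> q ->
    exists! l : line S, inc p l /\ inc q l;
  pr_A2 : exists a b c d : point S, four_points_no_three_collinear a b c d;
  pr_A3 : forall l : line S, exists a b c : point S,
    (a <> b /\ a <> c /\ b <> c) /\ (inc a l /\ inc b l /\ inc c l);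
  pr_A5 : forall s l : line S, special_line D s -> l <> s ->
    exists! p : point S, inc p s /\ inc p l;
  (* p_ij is a common point of m_i and l_j. *)
  pr_A6 : forall l1 l2 : line S,
    ordinary_line D l1 -> ordinary_line D l2 -> l1 <> l2 -> meet l1 l2 ->
    forall m1 m2 : line S, m1 <> m2 ->
    forall p11 p12 p21 p22 : point S,
      inc p11 m1 /\ inc p11 l1 ->
      inc p12 m1 /\ inc p12 l2 ->
      inc p21 m2 /\ inc p21 l1 ->
      inc p22 m2 /\ inc p22 l2 ->
      p11 <> p12 /\ p11 <> p21 /\ p11 <> p22 /\
      p12 <> p21 /\ p12 <> p22 /\ p21 <> p22 ->
      meet m1 m2
}.

Record projective_plane (S : incidence_structure) : Prop := ProjectivePlane {
  pp_join : forall p q : point S, p <> q ->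
    exists! l : line S, inc p l /\ inc q l;
  pp_meet : forall l m : line S, l <> m ->
    exists! p : point S, inc p l /\ inc p m;
  pp_quadrangle :
    exists a b c d : point S, four_points_no_three_collinear a b c d
}.

Definition nontrivial_projective_rectangle
    (S : incidence_structure) (D : point S) : Prop :=
  projective_rectangle S D /\ ~ projective_plane S.

(* Main.v *)
(* A6 is Pasch's axiom for two ordinary legs; it shows that two
   intersecting ordinary lines span a projective plane, that three noncollinear
   ordinary points lie in exactly one such plane, and that two planes sharing
   two points of a special line share their whole trace on it.  Since the
   rectangle is not a plane, there is always a centre O outside a given plane,
   lying on any prescribed special line, and harmonic configurations can be
   compared by projecting them from O into another plane through the base line,
   as in the three-dimensional proof of Desargues' theorem.

   If there are only three special lines the harmonic point is forced.  Otherwise: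
   - for an ordinary base line, every configuration is projected onto one with
     a2 = D.  Two of these, with fourth vertices c4 and c4', are both projections
     of one configuration a: if a4 is on O c4 and O' is the point of a4 c4' on
     the special line of O, then a2 is the point of e a4 on that line for both
     centres;
   - for a special base line, a configuration is determined by its plane, two
     special lines and one point; configurations in different planes that differ
     in both special lines are in perspective, and these steps connect all of them. *)
From Stdlib Require Import Classical FunctionalExtensionality PropExtensionality.
Require Import Defs.

Existing Class projective_rectangle.

(** * Lines through two points *)

Section Joins.
Context {S : incidence_structure} {D : point S}.
Context {PR : projective_rectangle S D}.
Implicit Types (p q r a b c d e f h x y z : point S) (l m : line S).

Lemma line_unique p q l m :
  p <> q -> inc p l -> inc q l -> inc p m -> inc q m -> l = m.
Proof.
intros n H1 H2 H3 H4. destruct (pr_A1 _ _ PR p q n) as [k [_ U]].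
rewrite <- (U l), <- (U m); auto.
Qed.

Lemma another_point p : exists q, q <> p.
Proof.
destruct (pr_A2 _ _ PR) as (a & b & _ & _ & (H & _) & _).
destruct (classic (a = p)) as [->|n]; [exists b | exists a]; congruence.
Qed.

Lemma join p q : exists l, inc p l /\ inc q l.
Proof.
destruct (classic (p = q)) as [<-|n].
- destruct (another_point p) as [r n].
  destruct (pr_A1 _ _ PR r p n) as [k [[_ H] _]]; eauto.
- destruct (pr_A1 _ _ PR p q n) as [k [H _]]; eauto.
Qed.

Lemma noncollinear_neq a b c : ~ collinear a b c -> a <> b /\ a <> c /\ b <> c.
Proof.
intro H. destruct (join a b) as (l & Ha & Hb), (join a c) as (m & Ha' & Hc).
repeat split; intros <-; apply H; [exists m | exists l | exists l]; auto.
Qed.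
End Joins.

(** * Automation for incidence arguments *)

Ltac is_new_neq a b :=
  lazymatch goal with
  | _ : a <> b |- _ => fail
  | _ : b <> a |- _ => fail
  | _ => idtac
  end.

Ltac inc_done :=
  match goal with
  | H : ?a <> ?a |- _ => exact (H eq_refl)
  | H : False |- _ => exact H
  | H : ~ inc ?p ?l, H' : inc ?p ?l |- _ => exact (H H')
  | H : ~ ?P, H' : ?P |- _ => exact (H H')
  | H : ~ collinear ?a ?b ?c, H1 : inc ?a ?l, H2 : inc ?b ?l, H3 : inc ?c ?l |- _ =>
      exact (H (ex_intro _ l (conj H1 (conj H2 H3))))
  end.

Ltac inc_conj :=
  repeat match goal with H : _ /\ _ |- _ => destruct H end.

Ltac inc_neq :=
  repeat match goal with
  | H : ~ collinear ?a ?b ?c |- _ =>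
      lazymatch goal with
      | _ : (a <> b /\ a <> c /\ b <> c) |- _ => fail
      | _ => pose proof (noncollinear_neq a b c H)
      end
  end;
  inc_conj;
  repeat match goal with
  | H : inc ?p ?l, H' : ~ inc ?q ?l |- _ =>
      is_new_neq p q; assert (p <> q) by (intros ->; exact (H' H))
  | H : ?P ?p, H' : ~ ?P ?q |- _ =>
      lazymatch type of p with point _ => idtac end;
      is_new_neq p q; assert (p <> q) by (intros ->; exact (H' H))
  end.

Ltac inc_neq_off :=
  match goal with
  | H : ~ collinear ?a ?b ?c, H1 : inc ?a ?l, H2 : inc ?b ?l, H3 : inc ?p ?l |- _ =>
      is_new_neq p c; assert (p <> c) by (intros ->; apply H; exists l; auto)
  | H : ~ collinear ?a ?b ?c, H1 : inc ?a ?l, H2 : inc ?c ?l, H3 : inc ?p ?l |- _ =>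
      is_new_neq p b; assert (p <> b) by (intros ->; apply H; exists l; auto)
  | H : ~ collinear ?a ?b ?c, H1 : inc ?b ?l, H2 : inc ?c ?l, H3 : inc ?p ?l |- _ =>
      is_new_neq p a; assert (p <> a) by (intros ->; apply H; exists l; auto)
  end.

Ltac inc_merge :=
  match goal with
  | H1 : inc ?p ?L, H2 : inc ?q ?L, H3 : inc ?p ?M, H4 : inc ?q ?M, N : ?p <> ?q |- _ =>
      tryif constr_eq L M then fail else
      (let E := fresh in
       pose proof (line_unique p q L M N H1 H2 H3 H4) as E;
       first [subst L | subst M])
  end.

Ltac inc_open :=
  repeat match goal with
  | H : collinear _ _ _ |- _ =>
     let L := fresh "L" in destruct H as (L & ? & ? & ?)
  end.

Ltac by_contra :=
  lazymatch goal with
  | |- False => idtac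
  | |- ~ _ => intro
  | |- _ => apply NNPP; intro
  end.

Ltac dup_clear :=
  repeat match goal with
  | H : inc ?p ?l, H' : inc ?p ?l |- _ => clear H'
  end.

Ltac inc_refute :=
  intros; repeat split; by_contra; subst; inc_conj; try inc_done;
  inc_neq; inc_open; dup_clear; try inc_done;
  repeat (first [inc_merge; dup_clear | inc_neq_off]; try inc_done).

Ltac inc_split :=
  match goal with
  | H1 : inc ?p ?L, H2 : inc ?q ?L, H3 : inc ?p ?M, H4 : inc ?q ?M |- _ =>
      tryif constr_eq L M then fail else
      tryif constr_eq p q then fail else
      let E := fresh in destruct (classic (p = q)) as [E|E]; [subst | ]
  end.

(* Refutes the negated goal by merging lines that share two distinct points,
   splitting at most twice on whether two common points of two lines coincide. *)
Ltac incid :=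
  intros;
  lazymatch goal with
  | |- False => idtac
  | |- ~ collinear _ _ _ => idtac
  | |- _ <> _ => idtac
  | |- ~ inc _ _ => idtac
  | |- collinear _ _ _ => idtac
  | |- inc _ _ => idtac
  | |- _ = _ => idtac
  | |- _ /\ _ => idtac
  end;
  solve [inc_refute | inc_refute; inc_split; inc_refute
        | inc_refute; inc_split; inc_refute; inc_split; inc_refute].

(** * Pasch's axiom and the planes generated by two ordinary lines *)

Section ProjectiveRectangle.
Context {S : incidence_structure} {D : point S}.
Context {PR : projective_rectangle S D}.
Implicit Types (p q r a b c d e f h x y z u v : point S) (l m : line S).

(* For ordinary points, [sp p q] says that p and q lie on one special line; it
   also holds when p or q is D.  Special lines ("fibers" in lemma names) are
   referred to by one of their ordinary points. *)
Local Notation sp := (collinear D).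

(** A6 in terms of points: [~ sp a b] and [~ sp a' b'] make the two legs through c ordinary, and the
    noncollinearities make the legs, the four points and the two crossing lines distinct. *)
Lemma pasch c a b a' b' : collinear c a b -> collinear c a' b' ->
  ~ sp a b -> ~ sp a' b' -> ~ collinear a b a' -> ~ collinear a b b' ->
  exists x, collinear a a' x /\ collinear b b' x.
Proof.
intros (l & Hc & Ha & Hb) (l' & Hc' & Ha' & Hb') n n' k k'.
destruct (join a a') as (m & ? & ?), (join b b') as (m' & ? & ?).
assert (M : meet m m').
{ apply (pr_A6 _ _ PR l l') with (p11 := a) (p12 := a') (p21 := b) (p22 := b'); auto.
  - unfold ordinary_line. intro. incid.
  - unfold ordinary_line. intro. incid.
  - intros ->. incid.
  - exists c; auto.
  - intros ->. incid.
  - inc_neq. auto 10. }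
destruct M as (x & ? & ?). exists x; split; [exists m | exists m']; auto.
Qed.

Lemma fiber_point p q r : ~ sp p q -> r <> D ->
  exists x, collinear p q x /\ sp r x /\ x <> D.
Proof.
intros n nr. destruct (join p q) as (l & Hp & Hq), (join D r) as (s & HD & Hr).
destruct (pr_A5 _ _ PR s l HD) as [x [[Hx Hx'] _]].
{ intros ->. incid. }
exists x; split; [exists l | split]; auto; [exists s; auto | intros ->; incid].
Qed.

Lemma third_point p q : p <> q -> exists r, collinear p q r /\ r <> p /\ r <> q.
Proof.
intro n. destruct (join p q) as (l & Hp & Hq).
destruct (pr_A3 _ _ PR l) as (a & b & c & (n1 & n2 & n3) & H1 & H2 & H3).
assert (A : forall x, inc x l -> x <> p -> x <> q -> exists r, collinear p q r /\ r <> p /\ r <> q).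
{ intros x ? ? ?. exists x; split; auto. exists l; auto. }
destruct (classic (a = p)), (classic (a = q)), (classic (b = p)), (classic (b = q));
 first [apply (A a); congruence | apply (A b); congruence | apply (A c); congruence].
Qed.

(* The ordinary points of a projective subplane through D. *)
Record plane (P : point S -> Prop) : Prop := Plane {
  plane_ordinary : forall p, P p -> p <> D;
  plane_closed : forall p q r, P p -> P q -> ~ sp p q -> collinear p q r -> P r;
  plane_meet : forall p q r x, P p -> P q -> P r -> P x -> ~ sp p q -> ~ sp r x ->
    exists y, collinear p q y /\ collinear r x y;
  plane_triangle : exists p q r, P p /\ P q /\ P r /\ ~ sp p q /\ ~ collinear p q r
}.

(** The condition [~ sp a b] keeps the line ab ordinary, so that Pasch applies to it. For distinct
    lines cu and cv a transversal misses c, which is why [plane_gen] adds c separately. *)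
Definition transversal c u v a b : Prop :=
  collinear c u a /\ collinear c v b /\ a <> c /\ b <> c /\ ~ sp a b.

(* The ordinary points of the plane spanned by the lines cu and cv. *)
Definition plane_gen c u v x : Prop :=
  x = c \/ exists a b, transversal c u v a b /\ collinear a b x.

Lemma plane_gen_swap c u v x : plane_gen c u v x -> plane_gen c v u x.
Proof.
intros [->|(a & b & (? & ? & ? & ? & ?) & ?)]; [left; auto|right].
exists b, a. repeat split; auto; incid.
Qed.

(** Distinct points of the ordinary line cv lie on distinct special lines, so v or a third point w
    has an ordinary join with x. *)
Lemma plane_gen_line c u v x : ~ sp c u -> ~ sp c v -> ~ collinear c u v ->
  collinear c u x -> plane_gen c u v x.
Proof.
intros n n' k H. destruct (classic (x = c)) as [|nx]; [left; auto|right].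
assert (c <> v) by incid. destruct (third_point c v) as (w & ? & ? & ?); auto.
destruct (classic (sp x v)).
- exists x, w. unfold transversal. repeat split; auto; incid.
- exists x, v. unfold transversal. repeat split; auto; incid.
Qed.

(** If x lies on the transversal ab, Pasch with vertex a and legs ac and ab makes px meet cb. *)
Lemma plane_gen_join c u v x p : ~ sp c u -> ~ sp c v -> ~ collinear c u v ->
  plane_gen c u v x -> ~ collinear c u x -> collinear c u p -> p <> c -> ~ sp p x ->
  exists b, transversal c u v p b /\ collinear p x b.
Proof.
intros n n' k G nx Hp np nsx.
destruct G as [->|(a & b & (Ha & Hb & na & nb & nab) & Hx)]; [exfalso; incid|].
destruct (classic (p = a)) as [->|npa].
{ exists b. unfold transversal. repeat split; auto; incid. }
destruct (classic (x = b)) as [->|nxb].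
{ exists b. unfold transversal. repeat split; auto; incid. }
destruct (pasch a p c x b) as (y & ? & ?); [incid .. |].
exists y. unfold transversal. repeat split; auto; try incid.
Qed.

(** When x and y are off cu and cv, a point p of cu is joined to both. The joins meet cv, so by
    Pasch with vertex p the line xy meets cv too, unless p is on xy; then xy meets cu by
    [plane_gen_join] with u and v exchanged. *)
Lemma plane_gen_transversal c u v x y : ~ sp c u -> ~ sp c v -> ~ collinear c u v ->
  plane_gen c u v x -> plane_gen c u v y -> ~ sp x y -> ~ collinear c x y ->
  exists a b, transversal c u v a b /\ collinear a b x /\ collinear a b y.
Proof.
intros n n' k Gx Gy nxy nc.
assert (W : forall u v x y, ~ sp c u -> ~ sp c v -> ~ collinear c u v ->
  plane_gen c u v x -> plane_gen c u v y -> ~ sp x y -> ~ collinear c x y -> collinear c u x ->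
  exists a b, transversal c u v a b /\ collinear a b x /\ collinear a b y).
{ clear - PR. intros u v x y n n' k Gx Gy nxy nc H.
  destruct (plane_gen_join c u v y x) as (b & ? & ?); [auto; incid .. |].
  exists x, b. unfold transversal in *. repeat split; auto; incid. }
assert (W' : forall u v x y, ~ sp c u -> ~ sp c v -> ~ collinear c u v ->
  plane_gen c u v x -> plane_gen c u v y -> ~ sp x y -> ~ collinear c x y ->
  collinear c u x \/ collinear c u y ->
  exists a b, transversal c u v a b /\ collinear a b x /\ collinear a b y).
{ clear - PR W. intros u v x y n n' k Gx Gy nxy nc [H|H]; auto.
  destruct (W u v y x) as (a & b & ? & ? & ?); [auto; incid .. |]. exists a, b; auto. }
destruct (classic (collinear c u x \/ collinear c u y)) as [?|K]; auto.
destruct (classic (collinear c v x \/ collinear c v y)) as [?|K'].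
{ destruct (W' v u x y) as (a & b & (? & ? & ? & ? & ?) & ? & ?);
  [auto using plane_gen_swap; incid .. |].
  exists b, a. unfold transversal. repeat split; auto; incid. }
apply not_or_and in K as [K1 K2]. apply not_or_and in K' as [K1' K2'].
destruct (classic (x = c)) as [->|nxc]; [exfalso; incid|].
(* The candidates are a and the point b' of cu on the special line of b. They lie on different
   special lines, neither being that of x, so one of them is also off that of y. *)
assert (exists p, collinear c u p /\ p <> c /\ ~ sp p x /\ ~ sp p y) as (p & Hp & npc & npx & npy).
{ destruct Gx as [->|(a & b & (Ha & Hb & na & nb & nab) & Hx)]; [exfalso; incid|].
  assert (b <> D) by incid.
  destruct (fiber_point c u b) as (b' & ? & ? & ?); auto.
  destruct (classic (sp a y)).
  - exists b'. repeat split; auto; try incid.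
  - exists a. repeat split; auto; incid. }
destruct (plane_gen_join c u v x p) as (bx & (? & ? & ? & ? & ?) & ?); auto.
destruct (plane_gen_join c u v y p) as (b & (? & ? & ? & ? & ?) & ?); auto.
destruct (classic (bx = b)) as [->|nb].
{ exists p, b. unfold transversal. repeat split; auto; incid. }
destruct (pasch p x bx y b) as (z & Hz & Hz'); [incid .. |].
destruct (plane_gen_join c v u x z) as (a & (? & ? & ? & ? & ?) & ?);
  [auto using plane_gen_swap; incid .. |].
exists a, z. unfold transversal. repeat split; auto; incid.
Qed.

(** In the main case p is the point of cu on the special line of x, so that yp is ordinary. By Pasch
    with vertex c, yp meets the transversal ab through x, and is therefore itself a transversal. *)
Lemma plane_gen_center c u v x y : ~ sp c u -> ~ sp c v -> ~ collinear c u v ->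
  plane_gen c u v x -> ~ sp c x -> collinear c x y -> plane_gen c u v y.
Proof.
intros n n' k G nx Hy.
destruct (classic (collinear c u x)).
{ apply plane_gen_line; auto. incid. }
destruct (classic (collinear c v x)).
{ apply plane_gen_swap, plane_gen_line; auto; incid. }
destruct (classic (y = c)) as [->|]; [left; auto|].
destruct (classic (y = x)) as [->|]; auto.
destruct G as [->|(a & b & (Ha & Hb & na & nb & nab) & Hx)]; [exfalso; incid|].
assert (x <> D) by incid.
destruct (fiber_point c u x) as (p & ? & ? & ?); auto.
destruct (pasch c y x p a) as (z & ? & ?); [incid .. |].
assert (plane_gen c u v z) by (right; exists a, b; repeat split; auto; incid).
destruct (plane_gen_join c u v z p) as (b' & ? & ?); [auto; incid .. |].
right. exists p, b'. split; auto. unfold transversal in *. incid.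
Qed.

(** The transversal ab and one through p, a'b', meet in a point z, by Pasch with vertex c or in a
    common end. Pasch with vertex a' or b' then makes cp meet ab. *)
Lemma plane_gen_meet_center c u v p a b : ~ sp c u -> ~ sp c v -> ~ collinear c u v ->
  plane_gen c u v p -> ~ sp c p -> transversal c u v a b ->
  exists y, collinear c p y /\ collinear a b y.
Proof.
intros n n' k G np (Ha & Hb & na & nb & nab).
destruct (classic (collinear c u p)). { exists a; incid. }
destruct (classic (collinear c v p)). { exists b; incid. }
destruct G as [->|(a' & b' & (Ha' & Hb' & na' & nb' & nab') & Hp)]; [exfalso; incid|].
assert (exists z, collinear a b z /\ collinear a' b' z) as (z & Hz & Hz').
{ destruct (classic (a = a')) as [->|]. { exists a'; incid. }
  destruct (classic (b = b')) as [->|]. { exists b'; incid. }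
  destruct (pasch c a a' b b') as (z & ? & ?); [incid .. |]. exists z; auto. }
destruct (classic (z = p)) as [->|]. { exists p; incid. }
destruct (classic (a = a')) as [->|].
- destruct (classic (b = b')) as [->|]. { exists p; incid. }
  destruct (pasch b' c b p z) as (y & ? & ?); [incid .. |]. exists y; incid.
- destruct (pasch a' c a p z) as (y & ? & ?); [incid .. |]. exists y; split; incid.
Qed.

(** An ordinary line through two points of the set passes through c or is a transversal, so
    everything reduces to the preceding lemmas and to Pasch with vertex c for two transversals. *)
Lemma plane_gen_plane c u v : ~ sp c u -> ~ sp c v -> ~ collinear c u v -> plane (plane_gen c u v).
Proof.
intros n n' k. split.
- intros p [->|(a & b & (Ha & Hb & na & nb & nab) & Hp)]; incid.
- intros p q r Gp Gq npq Hr.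
  destruct (classic (collinear c p q)) as [Hc|Hc].
  + destruct (classic (p = c)) as [->|].
    * apply plane_gen_center with q; auto.
    * apply plane_gen_center with p; auto; incid.
  + destruct (plane_gen_transversal c u v p q) as (a & b & T & ? & ?); auto.
    right. exists a, b; split; auto. destruct T as (? & ? & ? & ? & ?). incid.
- intros p q r x Gp Gq Gr Gx npq nrx.
  assert (W : forall p q, plane_gen c u v p -> plane_gen c u v q -> ~ sp p q -> collinear c p q ->
     exists o, plane_gen c u v o /\ ~ sp c o /\ forall y, collinear c o y -> collinear p q y).
  { clear - PR. intros p q Gp Gq npq H. destruct (classic (p = c)) as [->|].
    - exists q. repeat split; auto.
    - exists p. repeat split; auto; incid. }
  destruct (classic (collinear c p q)) as [Hc|Hc], (classic (collinear c r x)) as [Hc'|Hc'].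
  + exists c; incid.
  + destruct (W p q) as (o & ? & ? & K); auto.
    destruct (plane_gen_transversal c u v r x) as (a & b & T & ? & ?); auto.
    destruct (plane_gen_meet_center c u v o a b) as (y & ? & ?); auto.
    exists y; split; auto. destruct T as (? & ? & ? & ? & ?). incid.
  + destruct (W r x) as (o & ? & ? & K); auto.
    destruct (plane_gen_transversal c u v p q) as (a & b & T & ? & ?); auto.
    destruct (plane_gen_meet_center c u v o a b) as (y & ? & ?); auto.
    exists y; split; auto. destruct T as (? & ? & ? & ? & ?). incid.
  + destruct (plane_gen_transversal c u v p q) as (a & b & (? & ? & ? & ? & ?) & ? & ?); auto.
    destruct (plane_gen_transversal c u v r x) as (a' & b' & (? & ? & ? & ? & ?) & ? & ?); auto.
    assert (exists z, collinear a b z /\ collinear a' b' z) as (z & Hz & Hz').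
    { destruct (classic (a = a')) as [->|]. { exists a'; incid. }
      destruct (classic (b = b')) as [->|]. { exists b'; incid. }
      destruct (pasch c a a' b b') as (z & ? & ?); [incid .. |]. exists z; auto. }
    exists z; incid.
- exists c, u, v. repeat split; auto. { left; auto. }
  + apply plane_gen_line; auto; incid.
  + apply plane_gen_swap, plane_gen_line; auto; incid.
Qed.

(** * Planes through given points and intersections of planes *)

(** At most one of the three joins is special, so one of the points can be the vertex of two
    ordinary legs. *)
Lemma span p q r : p <> D -> q <> D -> r <> D -> ~ collinear p q r ->
  exists P, plane P /\ P p /\ P q /\ P r.
Proof.
intros np nq nr n.
assert (W : forall c u v, ~ sp c u -> ~ sp c v -> ~ collinear c u v ->
  exists P, plane P /\ P c /\ P u /\ P v).
{ clear - PR. intros c u v ? ? ?. exists (plane_gen c u v). refine (conj _ (conj _ (conj _ _))).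
  - apply plane_gen_plane; auto.
  - left; auto.
  - apply plane_gen_line; auto; incid.
  - apply plane_gen_swap, plane_gen_line; auto; incid. }
destruct (classic (sp p q)).
- destruct (W r p q) as (P & ? & ? & ? & ?); [incid .. |]. exists P; auto.
- destruct (classic (sp p r)).
  + destruct (W q p r) as (P & ? & ? & ? & ?); [incid .. |]. exists P; auto.
  + destruct (W p q r) as (P & ? & ? & ? & ?); [incid .. |]. exists P; auto.
Qed.

(** For y off pq, points z and o of pq are chosen with rz and oy ordinary. These lines meet in a
    point w, which lies in Q along rz; then y lies in Q along ow. *)
Lemma plane_sub P Q p q r : plane P -> plane Q -> ~ sp p q -> ~ collinear p q r ->
  P p -> P q -> P r -> Q p -> Q q -> Q r -> forall x, P x -> Q x.
Proof.
intros HP HQ n k Pp Pq Pr Qp Qq Qr y Py.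
pose proof (plane_ordinary _ HP _ Pp). pose proof (plane_ordinary _ HP _ Pr).
pose proof (plane_ordinary _ HP _ Py).
assert (exists z, collinear p q z /\ ~ sp r z) as (z & Hz & nz).
{ destruct (classic (sp r p)); [exists q | exists p]; incid. }
destruct (classic (collinear p q y)). { apply (plane_closed _ HQ p q); auto. }
assert (exists o, collinear p q o /\ o <> z /\ ~ sp o y) as (o & Ho & noz & noy).
{ assert (exists z', collinear p q z' /\ z' <> z) as (z' & ? & ?).
  { destruct (classic (p = z)) as [<-|]; [exists q | exists p]; incid. }
  assert (z <> z') by incid. destruct (third_point z z') as (z'' & ? & ? & ?); auto.
  destruct (classic (sp z' y)); [exists z'' | exists z']; incid. }
assert (Po : P o) by (apply (plane_closed _ HP p q); auto).
assert (Qo : Q o) by (apply (plane_closed _ HQ p q); auto).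
assert (Pz : P z) by (apply (plane_closed _ HP p q); auto).
assert (Qz : Q z) by (apply (plane_closed _ HQ p q); auto).
destruct (plane_meet _ HP o y r z) as (w & ? & ?); auto.
assert (Qw : Q w) by (apply (plane_closed _ HQ r z); auto).
apply (plane_closed _ HQ o w); auto; incid.
Qed.

(** Planes are made equal as predicates, so that membership can be rewritten from one to the other.
    If pq is special, pr serves as the ordinary side. *)
Lemma plane_eq P Q p q r : plane P -> plane Q -> ~ collinear p q r ->
  P p -> P q -> P r -> Q p -> Q q -> Q r -> P = Q.
Proof.
intros HP HQ k Pp Pq Pr Qp Qq Qr.
pose proof (plane_ordinary _ HP _ Pp). pose proof (plane_ordinary _ HP _ Pr).
pose proof (plane_ordinary _ HP _ Pq).
apply functional_extensionality; intro x; apply propositional_extensionality.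
destruct (classic (sp p q)).
- split; apply plane_sub with p r q; auto; incid.
- split; apply plane_sub with p q r; auto; incid.
Qed.

Lemma plane_common P Q p q r : plane P -> plane Q -> P <> Q ->
  P p -> P q -> P r -> Q p -> Q q -> Q r -> collinear p q r.
Proof. intros. apply NNPP; intro. eauto using plane_eq. Qed.

(* With f in P off the special line, b on zf, a on xb and yf, c in Q over b,
   o on fc and the special line, v on oa and cy, and w on ob and xv, the line cw
   of Q meets fb in a point of both planes, which can only be z. *)
Lemma plane_special P Q x y z : plane P -> plane Q -> x <> y -> sp x y -> sp x z ->
  P x -> P y -> P z -> Q x -> Q y -> Q z.
Proof.
intros HP HQ nxy Hy Hz Px Py Pz Qx Qy.
destruct (classic (P = Q)) as [<-|nPQ]; auto.
assert (K : forall r, P r -> Q r -> sp x r).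
{ intros r ? ?. pose proof (plane_ordinary _ HP _ Px).
  assert (collinear x y r) by (apply (plane_common P Q); auto). incid. }
destruct (classic (z = x)) as [->|nzx]; auto.
destruct (classic (z = y)) as [->|nzy]; auto.
pose proof (plane_ordinary _ HP _ Px). pose proof (plane_ordinary _ HP _ Py).
pose proof (plane_ordinary _ HP _ Pz).
assert (exists f, P f /\ ~ sp x f) as (f & Pf & nf).
{ destruct (plane_triangle _ HP) as (p & q & r & ? & ? & ? & ? & ?).
  destruct (classic (sp x p)); [exists q | exists p]; split; auto; incid. }
assert (z <> f) by incid.
destruct (third_point z f) as (b & Hb & nbz & nbf); auto.
assert (Pb : P b) by (apply (plane_closed _ HP z f); auto; incid).
destruct (plane_meet _ HP x b y f) as (a & Ha & Ha'); [auto; incid .. |].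
assert (Pa : P a) by (apply (plane_closed _ HP x b); auto; incid).
assert (exists c, Q c /\ sp b c) as (c & Qc & Hc).
{ destruct (plane_triangle _ HQ) as (p & q & r & ? & ? & ? & ? & ?).
  pose proof (plane_ordinary _ HP _ Pb).
  destruct (fiber_point p q b) as (c & ? & ? & ?); auto.
  exists c; split; auto. apply (plane_closed _ HQ p q); auto. }
pose proof (plane_ordinary _ HQ _ Qc).
assert (nPc : ~ P c). { intro Pc. pose proof (K c Pc Qc). incid. }
assert (nQb : ~ Q b). { intro Qb. pose proof (K b Pb Qb). incid. }
assert (nQa : ~ Q a). { intro Qa. pose proof (K a Pa Qa). incid. }
assert (nQf : ~ Q f). { intro Qf. pose proof (K f Pf Qf). incid. }
destruct (fiber_point f c x) as (o & Ho & Ho' & no); [auto; incid .. |].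
assert (o <> x /\ o <> y /\ o <> z) as (? & ? & ?).
{ repeat split; intros ->; apply nPc.
  - apply (plane_closed _ HP f x); auto; incid.
  - apply (plane_closed _ HP f y); auto; incid.
  - apply (plane_closed _ HP f z); auto; incid. }
destruct (pasch f o c a y) as (v & Hv & Hv'); [incid .. |].
destruct (pasch a b x o v) as (w & Hw & Hw'); [incid .. |].
assert (Qv : Q v) by (apply (plane_closed _ HQ c y); auto; incid).
assert (Qw : Q w) by (apply (plane_closed _ HQ x v); auto; incid).
destruct (pasch o c f w b) as (r & Hr & Hr'); [incid .. |].
assert (Qr : Q r) by (apply (plane_closed _ HQ c w); auto; incid).
assert (Pr : P r) by (apply (plane_closed _ HP f b); auto; incid).
pose proof (K r Pr Qr).
assert (r = z) by incid. congruence.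
Qed.

Lemma plane_collinear P Q p q r : plane P -> plane Q -> p <> q -> collinear p q r ->
  P p -> P q -> P r -> Q p -> Q q -> Q r.
Proof.
intros HP HQ n H Pp Pq Pr Qp Qq. destruct (classic (sp p q)).
- apply (plane_special P Q p q); auto.
  pose proof (plane_ordinary _ HP _ Pp). pose proof (plane_ordinary _ HP _ Pq). incid.
- apply (plane_closed _ HQ p q); auto.
Qed.

Lemma plane_inter P p q r x : plane P -> P p -> P q -> P r -> P x -> p <> q ->
  ~ sp r x -> ~ collinear p q r -> exists y, P y /\ collinear p q y /\ collinear r x y.
Proof.
intros HP Pp Pq Pr Px npq nrx n.
assert (exists y, collinear p q y /\ collinear r x y) as (y & ? & ?).
{ destruct (classic (sp p q)).
  - pose proof (plane_ordinary _ HP _ Pp). pose proof (plane_ordinary _ HP _ Pq).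
    destruct (fiber_point r x p) as (y & ? & ? & ?); auto. exists y; incid.
  - apply (plane_meet _ HP); auto. }
exists y; repeat split; auto. apply (plane_closed _ HP r x); auto.
Qed.

Lemma plane_fiber P p : plane P -> p <> D -> exists q, P q /\ sp p q.
Proof.
intros HP n. destruct (plane_triangle _ HP) as (a & b & c & ? & ? & ? & ? & ?).
destruct (fiber_point a b p) as (q & ? & ? & ?); auto.
exists q; split; auto. apply (plane_closed _ HP a b); auto.
Qed.

(** If P contained a whole special line, every ordinary point would be in P, on a line joining a
    point of P to a point of that special line. All lines would then meet, giving a projective
    plane. *)
Lemma fiber_off_plane P p : ~ projective_plane S -> plane P -> p <> D ->
  exists o, o <> D /\ sp p o /\ ~ P o.
Proof.
intros NT HP np. apply NNPP; intro K. apply NT.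
assert (Hs : forall o, o <> D -> sp p o -> P o).
{ intros o ? ?. apply NNPP; intro. apply K. exists o; auto. }
assert (Hall : forall x, x <> D -> P x).
{ intros x nx. destruct (classic (sp p x)); auto.
  (* Three points of an ordinary line of P lie on three different special lines, and at most two of
     these belong to p and x. *)
  assert (exists y, P y /\ ~ sp p y /\ ~ sp x y) as (y & Py & ? & ?).
  { destruct (plane_triangle _ HP) as (a & b & c & ? & ? & ? & ? & ?).
    assert (a <> b) by incid. destruct (third_point a b) as (r & ? & ? & ?); auto.
    assert (P r) by (apply (plane_closed _ HP a b); auto).
    destruct (classic (sp p a)), (classic (sp x a)), (classic (sp p b)), (classic (sp x b));
     first [exists a; repeat split; auto; incid | exists b; repeat split; auto; incid
           | exists r; repeat split; auto; incid]. }
  destruct (fiber_point x y p) as (z & ? & ? & ?); auto.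
  apply (plane_closed _ HP y z); auto; incid. }
split.
- apply (pr_A1 _ _ PR).
- intros l m n.
  assert (meet l m) as (x & Hl & Hm).
  { destruct (classic (inc D l)) as [Dl|nl].
    { destruct (pr_A5 _ _ PR l m Dl) as [x [[? ?] _]]; [congruence|]. exists x; auto. }
    destruct (classic (inc D m)) as [Dm|nm].
    { destruct (pr_A5 _ _ PR m l Dm) as [x [[? ?] _]]; [congruence|]. exists x; auto. }
    destruct (pr_A3 _ _ PR l) as (a & b & _ & (? & _ & _) & ? & ? & _).
    destruct (pr_A3 _ _ PR m) as (a' & b' & _ & (? & _ & _) & ? & ? & _).
    destruct (plane_meet _ HP a b a' b') as (x & (l' & ? & ? & ?) & (m' & ? & ? & ?));
      try (apply Hall; intros ->; contradiction); try incid.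
    exists x. rewrite (line_unique a b l l'), (line_unique a' b' m m'); auto. }
  exists x; split; auto. intros y [? ?]. apply NNPP; intro.
  apply n, (line_unique x y); auto.
- apply (pr_A2 _ _ PR).
Qed.

(** * Harmonic configurations and projection between planes *)

(* [harmonic_configuration] without the base line. *)
Definition conf d e f a1 a2 a3 a4 : Prop :=
  (d <> e /\ d <> f /\ e <> f /\ collinear d e f) /\
  (~ collinear d f a1 /\ ~ collinear d f a2 /\ ~ collinear d f a3 /\ ~ collinear d f a4) /\
  (~ collinear a1 a2 a3 /\ ~ collinear a1 a2 a4 /\
   ~ collinear a1 a3 a4 /\ ~ collinear a2 a3 a4) /\
  (collinear d a1 a2 /\ collinear d a4 a3 /\ collinear e a4 a2 /\
   collinear f a4 a1 /\ collinear f a3 a2).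

(** The other noncollinearities follow from the five incidences once a2 and a4 are distinct and off
    the base line. *)
Lemma conf_intro d e f a1 a2 a3 a4 :
  d <> e -> d <> f -> e <> f -> collinear d e f ->
  ~ collinear d f a2 -> ~ collinear d f a4 -> a2 <> a4 ->
  collinear d a1 a2 -> collinear d a4 a3 -> collinear e a4 a2 ->
  collinear f a4 a1 -> collinear f a3 a2 -> conf d e f a1 a2 a3 a4.
Proof.
intros.
assert (~ collinear d f a1) by incid. assert (~ collinear d f a3) by incid.
assert (~ collinear d a2 a4) by incid. assert (~ collinear f a2 a4) by incid.
assert (~ collinear a1 a2 a4) by incid. assert (~ collinear a3 a2 a4) by incid.
assert (~ collinear d a2 a3) by incid. assert (~ collinear f a4 a3) by incid.
unfold conf. repeat split; auto; try incid.
Qed.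

Lemma conf_iff l d e f a1 a2 a3 a4 : inc d l -> inc e l -> inc f l -> d <> f ->
  conf d e f a1 a2 a3 a4 <-> harmonic_configuration l d e f a1 a2 a3 a4.
Proof.
intros Hd He Hf n.
assert (L : forall x, inc x l <-> collinear d f x).
{ intro x; split; [exists l; auto | intros (l' & ? & ? & ?)].
  rewrite (line_unique d f l l'); auto. }
split.
- intros (? & ? & ? & ?). split; rewrite ?L; try tauto.
  + repeat split; auto; incid.
  + unfold four_points_no_three_collinear. split; [|tauto]. repeat split; incid.
- intros [? ? ? [_ ?] ? ? ? ? ?]. rewrite ?L in *. unfold conf.
  repeat split; try tauto. exists l; rewrite !L; auto.
Qed.

(** Reversing the base exchanges a1 and a3 and keeps the line through them, so an argument about a1
    also serves for a3. *)
Lemma conf_swap d e f a1 a2 a3 a4 : conf d e f a1 a2 a3 a4 -> conf f e d a3 a2 a1 a4.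
Proof. intros C. unfold conf in *. inc_conj. repeat split; auto; incid. Qed.

Lemma conf_rot d e f a1 a2 a3 a4 : conf d e f a1 a2 a3 a4 -> conf d e f a3 a4 a1 a2.
Proof. intros C. unfold conf in *. inc_conj. repeat split; auto; incid. Qed.

Lemma off_plane_noncollinear P o p q : plane P -> ~ P o -> P p -> P q -> p <> q -> ~ sp o p ->
  ~ collinear o p q.
Proof.
intros HP no Pp Pq n ns H. pose proof (plane_ordinary _ HP _ Pp).
apply no, (plane_closed _ HP p q); auto; incid.
Qed.

(** In the plane of o, d, p the line dp' meets or; likewise fq' meets or. Both points lie in P' on
    the ordinary line or, so they coincide, as o is not in P'. *)
Lemma desargues P P' o d f p q r p' q' : plane P -> plane P' -> ~ P o -> ~ P' o -> o <> D ->
  P d -> P f -> P' d -> P' f -> P p -> P q -> P r -> P' p' -> P' q' ->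
  d <> p -> f <> q -> collinear d p r -> collinear f q r ->
  ~ sp o p -> ~ sp o q -> ~ sp o r -> collinear o p p' -> collinear o q q' ->
  exists r', P' r' /\ collinear o r r' /\ collinear d p' r' /\ collinear f q' r'.
Proof.
intros HP HP' no no' oD Pd Pf Pd' Pf' Pp Pq Pr Pp' Pq' ndp nfq Hr Hr' np nq nr Hp' Hq'.
assert (W : forall d p p', P d -> P' d -> P p -> P' p' -> d <> p -> collinear d p r -> ~ sp o p ->
  collinear o p p' -> exists r', P' r' /\ collinear o r r' /\ collinear d p' r').
{ clear - PR HP HP' no no' oD Pr nr. intros d p p' Pd Pd' Pp Pp' ndp H np Hp'.
  assert (~ collinear o p d) by (apply (off_plane_noncollinear P); auto).
  destruct (span o d p) as (B & HB & Bo & Bd & Bp); [auto; try incid .. |].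
  { apply (plane_ordinary _ HP); auto. }
  assert (Bp' : B p') by (apply (plane_closed _ HB o p); auto).
  assert (Br : B r) by (apply (plane_collinear P B d p); auto).
  assert (~ collinear o p' d).
  { apply (off_plane_noncollinear P'); auto; incid. }
  destruct (plane_inter B d p' o r) as (r' & ? & ? & ?); [auto; incid .. |].
  exists r'; repeat split; auto. apply (plane_collinear B P' d p'); auto; incid. }
destruct (W d p p') as (r1 & ? & ? & ?); auto.
destruct (W f q q') as (r2 & ? & ? & ?); auto.
destruct (classic (r1 = r2)) as [<-|]. { exists r1; auto. }
exfalso. apply no', (plane_closed _ HP' r1 r2); auto; incid.
Qed.

(* Otherwise ox would meet P in two points, one on each special line. *)
Lemma meet_in_fiber P B C o d p f q x : plane P -> plane B -> plane C -> ~ P o -> o <> D ->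
  P d -> P p -> P f -> P q -> d <> p -> f <> q -> sp d p -> sp f q -> ~ sp d f ->
  B o -> B d -> B p -> B x -> C o -> C f -> C q -> C x -> sp o x.
Proof.
intros HP HB HC no oD Pd Pp Pf Pq ndp nfq Hdp Hfq ndf Bo Bd Bp Bx Co Cf Cq Cx.
apply NNPP; intro n.
assert (W : forall B d p, plane B -> P d -> P p -> d <> p -> sp d p -> B o -> B d -> B p -> B x ->
  exists g, P g /\ sp d g /\ collinear o x g).
{ clear - PR HP no oD n. intros B d p HB Pd Pp ndp Hdp Bo Bd Bp Bx.
  pose proof (plane_ordinary _ HP _ Pd).
  destruct (fiber_point o x d) as (g & ? & ? & ?); auto.
  exists g; repeat split; auto. apply (plane_special B P d p); auto.
  apply (plane_closed _ HB o x); auto. }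
destruct (W B d p) as (g & ? & ? & ?); auto.
destruct (W C f q) as (g' & ? & ? & ?); auto.
pose proof (plane_ordinary _ HP _ Pd). pose proof (plane_ordinary _ HP g).
pose proof (plane_ordinary _ HP g').
apply no, (plane_closed _ HP g g'); auto; incid.
Qed.

(** P and A differ because only A contains o, so their common points a1, h, k are collinear; k is in
    A because it lies on c1 c3. If h and k lie on a base line missing a1, they coincide. *)
Lemma conjugate_unique P P' A o a1 a3 c1 c3 h k : plane P -> plane P' -> plane A -> ~ P o ->
  A o -> A a1 -> A a3 -> A c1 -> A c3 -> P a1 -> P a3 -> P h -> P k -> P' c1 -> P' c3 -> P' k ->
  a1 <> a3 -> c1 <> c3 -> collinear a1 a3 h -> collinear c1 c3 k -> collinear a1 h k.
Proof.
intros HP HP' HA no Ao A1 A3 C1 C3 P1 P3 Ph Pk P'1 P'3 P'k n n' H H'.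
assert (Ah : A h) by (apply (plane_collinear P A a1 a3); auto).
assert (Ak : A k) by (apply (plane_collinear P' A c1 c3); auto).
apply NNPP; intro. apply no. rewrite (plane_eq P A a1 h k); auto.
Qed.

(** * Ordinary base line: projecting configurations with second vertex D *)

(* A point b on o c1 and f a4 satisfies: db meets e a4 in a point of the special
   line of o, which must be a2. *)
Lemma normal_half d e f c1 c3 c4 a1 a2 a3 a4 P P' o :
  conf d e f c1 D c3 c4 -> conf d e f a1 a2 a3 a4 -> ~ sp d f ->
  plane P -> P d -> P f -> P c4 -> plane P' -> P' d -> P' f -> P' a4 ->
  ~ P o -> ~ P' o -> o <> D -> ~ sp o d -> ~ sp o e -> ~ sp o f ->
  collinear o c4 a4 -> a4 <> c4 -> a4 <> o -> sp o a2 -> a2 <> D ->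
  P c1 /\ P' a1 /\ collinear o c1 a1 /\ ~ sp o c1.
Proof.
intros Cc Ca ndf HP Pd Pf Pc4 HP' Pd' Pf' Pa4' no no' oD nd ne nf Ho n4 n4' H2 nD2.
unfold conf in Cc, Ca. inc_conj.
assert (Pe : P e) by (apply (plane_closed _ HP d f); auto; incid).
assert (Pe' : P' e) by (apply (plane_closed _ HP' d f); auto; incid).
assert (sp d c1) by incid. assert (sp e c4) by incid.
assert (c1 <> D) by incid. assert (c4 <> D) by incid.
assert (d <> D) by incid. assert (e <> D) by incid. assert (f <> D) by incid.
assert (~ sp d e) by incid. assert (~ sp e f) by incid.
assert (~ sp f c4) by incid. assert (~ sp o c4) by incid. assert (~ sp o c1) by incid.
assert (Pc1 : P c1) by (apply (plane_closed _ HP f c4); auto).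
assert (nPa4 : ~ P a4). { intro. apply no, (plane_closed _ HP c4 a4); auto; incid. }
assert (~ sp e a4) by incid. assert (~ sp d a2) by incid. assert (~ sp o a4) by incid.
assert (Pa2' : P' a2) by (apply (plane_closed _ HP' e a4); auto).
assert (Pa1' : P' a1) by (apply (plane_closed _ HP' d a2); auto; incid).
split; auto. split; auto. split; auto.
assert (~ collinear o c4 f) by (apply (off_plane_noncollinear P); auto; incid).
assert (~ collinear o c1 d) by (apply (off_plane_noncollinear P); auto; incid).
assert (~ collinear o c4 e) by (apply (off_plane_noncollinear P); auto; incid).
assert (exists b, collinear f a4 b /\ collinear o c1 b /\ P' b) as (b & Hb & Hb' & Pb').
{ destruct (span o c4 f) as (C & HC & Co & C4 & Cf); auto.
  assert (Ca4 : C a4) by (apply (plane_closed _ HC o c4); auto).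
  assert (Cc1 : C c1) by (apply (plane_closed _ HC f c4); auto; incid).
  destruct (plane_inter C f a4 o c1) as (b & Cb & ? & ?); [auto; incid .. |].
  exists b; repeat split; auto. apply (plane_collinear C P' f a4); auto; incid. }
assert (b <> c1). { intros ->. apply nPa4, (plane_closed _ HP f c1); auto; incid. }
assert (nPb : ~ P b). { intro. apply no, (plane_closed _ HP b c1); auto; incid. }
assert (~ collinear d b e). { intro. apply nPb, (plane_closed _ HP d e); auto; incid. }
destruct (plane_inter P' d b e a4) as (x & Px' & Hx & Hx'); [auto; incid .. |].
assert (x <> D) by (apply (plane_ordinary _ HP'); auto).
assert (sp o x).
{ destruct (span o d c1) as (B & HB & Bo & Bd & Bc1); [auto; incid .. |].
  destruct (span o e c4) as (C & HC & Co & Ce & Cc4); [auto; incid .. |].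
  assert (Bb : B b) by (apply (plane_closed _ HB o c1); auto).
  assert (Ca4 : C a4) by (apply (plane_closed _ HC o c4); auto).
  assert (~ sp d b) by incid.
  apply (meet_in_fiber P B C o d c1 e c4 x); auto; try incid.
  - apply (plane_closed _ HB d b); auto.
  - apply (plane_closed _ HC e a4); auto. }
assert (x = a2) by incid. subst x.
assert (b = a1) by incid. congruence.
Qed.

(** [normal_half], applied also to the reversed base, puts a1 on oc1 and a3 on oc3. The plane of o,
    c1, c3 then contains a1 and a3, as [conjugate_unique] needs. *)
Lemma normal_projection d e f c1 c3 c4 a1 a2 a3 a4 P o h k :
  conf d e f c1 D c3 c4 -> conf d e f a1 a2 a3 a4 -> ~ sp d f ->
  plane P -> P d -> P f -> P c4 -> ~ P o -> o <> D -> ~ sp o d -> ~ sp o e -> ~ sp o f ->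
  collinear o c4 a4 -> a4 <> c4 -> a4 <> o -> sp o a2 -> a2 <> D ->
  collinear d f h -> collinear c1 c3 h -> collinear d f k -> collinear a1 a3 k -> h = k.
Proof.
intros Cc Ca ndf HP Pd Pf Pc4 no oD nd ne nf Ho n4 n4' H2 nD2 Hh Hh' Hk Hk'.
assert (~ sp o c4 /\ c4 <> D) as [? ?].
{ unfold conf in Cc. inc_conj. assert (e <> D) by incid. incid. }
assert (nPa4 : ~ P a4). { intro. apply no, (plane_closed _ HP c4 a4); auto; incid. }
destruct (span d f a4) as (P' & HP' & Pd' & Pf' & Pa4'); [try incid .. |].
{ unfold conf in Ca; tauto. }
assert (no' : ~ P' o).
{ intro. apply nPa4. rewrite (plane_eq P P' d f c4); auto.
  - unfold conf in Cc; tauto.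
  - apply (plane_closed _ HP' o a4); auto; incid. }
destruct (normal_half d e f c1 c3 c4 a1 a2 a3 a4 P P' o) as (P1 & P1' & H1 & n1); auto.
apply conf_swap in Cc, Ca.
destruct (normal_half f e d c3 c1 c4 a3 a2 a1 a4 P P' o) as (P3 & P3' & H3 & n3);
  [auto; incid .. |].
assert (c1 <> c3 /\ a1 <> a3 /\ ~ collinear d f c1) as (? & ? & ?).
{ unfold conf in *. inc_conj. repeat split; auto; incid. }
assert (~ collinear o c1 c3) by (apply (off_plane_noncollinear P); auto).
destruct (span o c1 c3) as (A & HA & Ao & A1 & A3); [auto; incid .. |].
assert (collinear c1 h k).
{ apply (conjugate_unique P P' A o c1 c3 a1 a3); auto.
  - apply (plane_closed _ HA o c1); auto.
  - apply (plane_closed _ HA o c3); auto.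
  - apply (plane_closed _ HP d f); auto.
  - apply (plane_closed _ HP d f); auto.
  - apply (plane_closed _ HP' d f); auto. }
incid.
Qed.

Lemma normal_exists d e f c4 : d <> e -> d <> f -> e <> f -> collinear d e f -> ~ sp d f ->
  c4 <> D -> c4 <> e -> sp e c4 -> exists c1 c3, conf d e f c1 D c3 c4.
Proof.
intros nde ndf nef H ns n4 n4' H4.
assert (d <> D) by incid. assert (f <> D) by incid.
destruct (fiber_point f c4 d) as (c1 & ? & ? & ?); [auto; incid .. |].
destruct (fiber_point d c4 f) as (c3 & ? & ? & ?); [auto; incid .. |].
exists c1, c3. apply conf_intro; auto; incid.
Qed.

(** If a1 a3 is special, A5 suffices. Otherwise Pasch applies with vertex a2, or with vertex a4 when
    a2 d or a2 f is special. *)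
Lemma conf_meet d e f a1 a2 a3 a4 : conf d e f a1 a2 a3 a4 -> ~ sp d f ->
  exists h, collinear d f h /\ collinear a1 a3 h.
Proof.
intros C ns. unfold conf in C. inc_conj.
destruct (classic (sp a1 a3)).
- destruct (classic (a1 = D)) as [->|].
  + destruct (fiber_point d f a3) as (h & ? & ? & ?); [auto; incid .. |]. exists h; auto.
  + destruct (fiber_point d f a1) as (h & ? & ? & ?);
  [auto; incid .. |]. exists h; split; auto; incid.
- assert (a1 <> D) by incid. assert (a3 <> D) by incid.
  destruct (classic (sp d a2 \/ sp f a2)) as [Hs|Hs].
  + destruct (pasch a4 d a3 f a1) as (h & ? & ?); [try incid .. |].
    all: try (destruct Hs; incid). exists h; incid.
  + apply not_or_and in Hs as [? ?].
    destruct (pasch a2 d a1 f a3) as (h & ? & ?); [incid .. |]. exists h; incid.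
Qed.

(** The existence of at least four special lines, in the form used to choose centres. *)
Definition four_fibers : Prop := forall p q r, p <> D -> q <> D -> r <> D ->
  exists t, t <> D /\ ~ sp p t /\ ~ sp q t /\ ~ sp r t.

(** With t on a fourth special line, any three special lines would miss one of x, y, z, t. *)
Lemma three_fibers x y z t : ~ four_fibers -> ~ sp x y -> ~ sp x z -> ~ sp y z ->
  x <> D -> y <> D -> z <> D -> t <> D -> sp x t \/ sp y t \/ sp z t.
Proof.
intros N xy xz yz nx ny nz nt. apply NNPP; intro K. apply N. intros p q r np nq nr.
apply not_or_and in K as [Kx K]. apply not_or_and in K as [Ky Kz].
apply NNPP; intro M.
assert (B : forall o, o <> D -> sp p o \/ sp q o \/ sp r o).
{ intros o no. apply NNPP; intro L. apply M. exists o. tauto. }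
destruct (B x nx) as [|[|]], (B y ny) as [|[|]], (B z nz) as [|[|]], (B t nt) as [|[|]]; incid.
Qed.

(** * Ordinary base line with at least four special lines *)

Section FourFibers.
Context (NT : ~ projective_plane S) (fourth_fiber : four_fibers).

Lemma conf_in_plane P d e f a2 a4 : plane P -> P d -> P f -> P a2 -> P a4 ->
  d <> e -> d <> f -> e <> f -> collinear d e f -> ~ collinear d f a2 -> ~ collinear d f a4 ->
  a2 <> a4 -> collinear e a4 a2 -> ~ sp d a2 -> ~ sp f a2 ->
  exists a1 a3, conf d e f a1 a2 a3 a4.
Proof.
intros HP Pd Pf P2 P4 nde ndf nef H n2 n4 n24 H42 s2 s2'.
destruct (plane_inter P f a4 d a2) as (a1 & ? & ? & ?); [auto; incid .. |].
destruct (plane_inter P d a4 f a2) as (a3 & ? & ? & ?); [auto; incid .. |].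
exists a1, a3. apply conf_intro; auto; incid.
Qed.

Lemma normal_unique d e f c1 c3 c4 c1' c3' c4' h h' : ~ sp d f ->
  conf d e f c1 D c3 c4 -> conf d e f c1' D c3' c4' ->
  collinear d f h -> collinear c1 c3 h -> collinear d f h' -> collinear c1' c3' h' -> h = h'.
Proof.
intros ns C C' Hh1 Hh2 Hh1' Hh2'.
assert (exists a1 a2 a3 a4 o o' P P', conf d e f a1 a2 a3 a4 /\ a2 <> D /\
  (plane P /\ P d /\ P f /\ P c4 /\ ~ P o /\ o <> D /\ ~ sp o d /\ ~ sp o e /\ ~ sp o f /\
   collinear o c4 a4 /\ a4 <> c4 /\ a4 <> o /\ sp o a2) /\
  (plane P' /\ P' d /\ P' f /\ P' c4' /\ ~ P' o' /\ o' <> D /\ ~ sp o' d /\ ~ sp o' e /\ ~ sp o' f /\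
   collinear o' c4' a4 /\ a4 <> c4' /\ a4 <> o' /\ sp o' a2))
  as (a1 & a2 & a3 & a4 & o & o' & P & P' & Ca & n2 & K & K').
{ clear Hh1 Hh2 Hh1' Hh2'.
  assert (d <> e /\ d <> f /\ e <> f /\ collinear d e f /\ ~ collinear d f c4 /\
    ~ collinear d f c4' /\ sp e c4 /\ sp e c4' /\ c4 <> D /\ c4' <> D)
    as (nde & ndf & nef & H & n4 & n4' & s4 & s4' & nD & nD').
  { unfold conf in *. inc_conj. repeat split; auto; incid. }
  clear C C' c1 c3 c1' c3'.
  assert (d <> D) by incid. assert (e <> D) by incid. assert (f <> D) by incid.
  assert (~ sp d e) by incid. assert (~ sp e f) by incid.
  destruct (fourth_fiber d e f) as (t & nt & td & te & tf); auto.
  destruct (span d f c4) as (P & HP & Pd & Pf & Pc4); auto.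
  destruct (span d f c4') as (P' & HP' & Pd' & Pf' & Pc4'); auto.
  destruct (fiber_off_plane P t) as (o & no & Hto & noP); auto.
  assert (~ sp o d) by incid. assert (~ sp o e) by incid. assert (~ sp o f) by incid.
  assert (~ sp o c4) by incid.
  (* If the points of oc4 on the special lines of d and f were both in P', then o and c4 would be
     too, forcing P = P' although o is not in P. *)
  assert (exists a4, collinear o c4 a4 /\ a4 <> o /\ a4 <> c4 /\ ~ P' a4) as (a4 & Ha4 & na4 & na4' & nP').
  { destruct (fiber_point o c4 d) as (x & ? & ? & ?); auto.
    destruct (fiber_point o c4 f) as (y & ? & ? & ?); auto.
    destruct (classic (P' x)) as [Px|]; [destruct (classic (P' y)) as [Py|]|].
    - exfalso. apply noP. rewrite (plane_eq P P' d f c4); auto;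
        apply (plane_closed _ HP' x y); auto; incid.
    - exists y; repeat split; auto; incid.
    - exists x; repeat split; auto; incid. }
  assert (nP : ~ P a4). { intro. apply noP, (plane_closed _ HP c4 a4); auto; incid. }
  assert (~ sp e a4) by incid. assert (~ sp o a4) by incid.
  assert (~ sp a4 c4') by incid.
  (* With o' on the special line of o, a single point a2 of that line serves for both centres. *)
  destruct (fiber_point a4 c4' o) as (o' & Ho' & so' & no'); auto.
  destruct (fiber_point e a4 o) as (a2 & Ha2 & sa2 & na2); auto.
  assert (~ collinear d f a4). { intro. apply nP, (plane_closed _ HP d f); auto. }
  assert (~ sp e a2) by incid.
  destruct (span d f a4) as (Q & HQ & Qd & Qf & Qa4); [auto; incid .. |].
  assert (Qe : Q e) by (apply (plane_closed _ HQ d f); auto; incid).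
  assert (Qa2 : Q a2) by (apply (plane_closed _ HQ e a4); auto; incid).
  destruct (conf_in_plane Q d e f a2 a4) as (a1 & a3 & Ca); [auto; incid .. |].
  exists a1, a2, a3, a4, o, o', P, P'. split; auto. split; auto. split.
  - repeat split; auto; try apply HP; incid.
  - refine (conj HP' (conj Pd' (conj Pf' (conj Pc4' _)))). split.
    + intro. apply nP', (plane_closed _ HP' o' c4'); auto; incid.
    + repeat split; auto; incid. }
destruct (conf_meet d e f a1 a2 a3 a4) as (k & Hk1 & Hk2); auto.
transitivity k.
- apply (normal_projection d e f c1 c3 c4 a1 a2 a3 a4 P o); tauto.
- symmetry. apply (normal_projection d e f c1' c3' c4' a1 a2 a3 a4 P' o'); tauto.
Qed.

(** The reference value with which every configuration is compared; by [normal_unique] one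
    configuration with second vertex D determines it. *)
Definition normal_value d e f k := forall c1 c3 c4 h,
  conf d e f c1 D c3 c4 -> collinear d f h -> collinear c1 c3 h -> h = k.

(** The centre o is taken on the special line of a2, outside the plane of the configuration, and a4
    is projected to c4 on the special line of e. [normal_projection] then compares with the
    configuration built on c4. *)
Lemma generic_value d e f a1 a2 a3 a4 k : ~ sp d f -> conf d e f a1 a2 a3 a4 ->
  a2 <> D -> ~ sp d a2 -> ~ sp e a2 -> ~ sp f a2 ->
  collinear d f k -> collinear a1 a3 k -> normal_value d e f k.
Proof.
intros ns C n2 nd ne nf Hk1 Hk2.
assert (exists o P c4, conf d e f a1 a2 a3 a4 /\ c4 <> D /\ c4 <> e /\ sp e c4 /\
   plane P /\ P d /\ P f /\ P c4 /\ ~ P o /\ o <> D /\ ~ sp o d /\ ~ sp o e /\ ~ sp o f /\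
   collinear o c4 a4 /\ a4 <> c4 /\ a4 <> o /\ sp o a2)
  as (o & P & c4 & K).
{ pose proof C as C'. unfold conf in C'. inc_conj.
  assert (d <> D) by incid. assert (e <> D) by incid. assert (f <> D) by incid.
  destruct (span d f a2) as (P & HP & Pd & Pf & P2); auto.
  assert (Pe : P e) by (apply (plane_closed _ HP d f); auto; incid).
  assert (P4 : P a4) by (apply (plane_closed _ HP e a2); auto; incid).
  destruct (fiber_off_plane P a2) as (o & no & Ho & noP); auto.
  assert (~ sp o a4) by incid.
  destruct (fiber_point o a4 e) as (c4 & ? & ? & ?); auto.
  assert (nPc4 : ~ P c4). { intro. apply noP, (plane_closed _ HP c4 a4); auto; incid. }
  destruct (span d f c4) as (P' & HP' & Pd' & Pf' & Pc4'); auto.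
  { intro. apply nPc4, (plane_closed _ HP d f); auto. }
  exists o, P', c4. split; auto. split; auto. split. { intros ->; auto. }
  split; auto. split; auto. split; auto. split; auto. split; auto.
  split; [|repeat split; auto; incid].
  intro. apply nPc4. rewrite (plane_eq P P' d f a4); auto.
  apply (plane_closed _ HP' o c4); auto; incid. }
destruct (normal_exists d e f c4) as (c1 & c3 & Cc); try tauto; try (unfold conf in C; tauto).
destruct (conf_meet d e f c1 D c3 c4) as (h & Hh1 & Hh2); auto.
assert (h = k) as <-.
{ apply (normal_projection d e f c1 c3 c4 a1 a2 a3 a4 P o); tauto. }
intros x1 x3 x4 y ? ? ?. apply (normal_unique d e f x1 x3 x4 c1 c3 c4); auto.
Qed.

(** One of a2 and a4 is off the special lines of d and f: otherwise a2 a4 would pass through d or f,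
    or a1 or a3 would be D. *)
Lemma ordinary_value d e f a1 a2 a3 a4 k : ~ sp d f -> conf d e f a1 a2 a3 a4 ->
  a1 <> D -> a2 <> D -> a3 <> D -> a4 <> D -> ~ sp e a2 ->
  collinear d f k -> collinear a1 a3 k -> normal_value d e f k.
Proof.
intros ns C n1 n2 n3 n4 ne Hk1 Hk2.
pose proof C as C'. unfold conf in C'. inc_conj.
assert (~ sp e a4) by incid.
destruct (classic (sp d a2 \/ sp f a2)) as [K|K];
  [|apply not_or_and in K as [? ?]; apply (generic_value d e f a1 a2 a3 a4 k); auto].
destruct (classic (sp d a4 \/ sp f a4)) as [K'|K'];
  [|apply not_or_and in K' as [? ?]; apply (generic_value d e f a3 a4 a1 a2 k); auto;
    [apply conf_rot; auto | incid]].
exfalso. destruct K, K'; incid.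
Qed.

(** Two uses of [desargues] complete c2 and c4 to the projection of the whole configuration from o,
    to which [ordinary_value] applies. *)
Lemma projected_value d e f a1 a2 a3 a4 k P o c2 c4 : ~ sp d f -> conf d e f a1 a2 a3 a4 ->
  plane P -> P d -> P f -> P a1 -> P a2 -> P a3 -> P a4 -> ~ P o -> o <> D ->
  ~ sp o a1 -> ~ sp o a2 -> ~ sp o a3 -> ~ sp o a4 ->
  collinear o a2 c2 -> c2 <> a2 -> c2 <> o -> ~ sp e c2 ->
  collinear o a4 c4 -> collinear e c2 c4 ->
  collinear d f k -> collinear a1 a3 k -> normal_value d e f k.
Proof.
intros ns C HP Pd Pf P1 P2 P3 P4 noP no s1 s2 s3 s4 H2 n2 n2' se H4 He Hk1 Hk2.
assert (d <> e /\ d <> f /\ e <> f /\ collinear d e f /\ ~ collinear d f a2 /\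
  ~ collinear d f a4 /\ ~ collinear d f a1 /\ a2 <> a4 /\ a1 <> a3 /\
  collinear d a1 a2 /\ collinear d a4 a3 /\ collinear e a4 a2 /\
  collinear f a4 a1 /\ collinear f a3 a2)
  as (nde & ndf & nef & H & k2 & k4 & k1 & n24 & n13 & C1 & C2 & C3 & C4 & C5).
{ unfold conf in C. inc_conj. repeat split; auto; incid. }
clear C.
assert (nPc2 : ~ P c2). { intro. apply noP, (plane_closed _ HP a2 c2); auto; incid. }
assert (~ collinear d f c2). { intro. apply nPc2, (plane_closed _ HP d f); auto. }
destruct (span d f c2) as (P' & HP' & Pd' & Pf' & P2'); [incid .. |].
assert (noP' : ~ P' o).
{ intro. apply nPc2. rewrite (plane_eq P P' d f a2); auto.
  apply (plane_closed _ HP' o c2); auto; incid. }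
assert (Pe' : P' e) by (apply (plane_closed _ HP' d f); auto; incid).
assert (P4' : P' c4) by (apply (plane_closed _ HP' e c2); auto).
assert (~ collinear o a4 a2) by (apply (off_plane_noncollinear P); auto).
assert (nP4 : ~ P c4).
{ intro. assert (c4 <> a4).
  { intros ->. assert (P = P') by (apply (plane_eq P P' d f a4); auto). congruence. }
  apply noP, (plane_closed _ HP a4 c4); auto; incid. }
assert (~ collinear d f c4). { intro. apply nP4, (plane_closed _ HP d f); auto. }
destruct (desargues P P' o d f a2 a4 a1 c2 c4) as (c1 & P1' & ? & ? & ?); [auto; incid .. |].
destruct (desargues P P' o f d a2 a4 a3 c2 c4) as (c3 & P3' & ? & ? & ?); [auto; incid .. |].
assert (Cc : conf d e f c1 c2 c3 c4).
{ apply conf_intro; auto; incid. }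
destruct (conf_meet d e f c1 c2 c3 c4) as (h & Hh1 & Hh2); auto.
assert (normal_value d e f h).
{ apply (ordinary_value d e f c1 c2 c3 c4); auto; apply (plane_ordinary _ HP'); auto. }
assert (c1 <> c3). { unfold conf in Cc. inc_conj. incid. }
assert (~ collinear o a1 a3) by (apply (off_plane_noncollinear P); auto).
destruct (span o a1 a3) as (A & HA & Ao & A1 & A3); [auto; incid .. |].
assert (collinear a1 k h).
{ apply (conjugate_unique P P' A o a1 a3 c1 c3); auto.
  - apply (plane_closed _ HA o a1); auto.
  - apply (plane_closed _ HA o a3); auto.
  - apply (plane_closed _ HP d f); auto.
  - apply (plane_closed _ HP d f); auto.
  - apply (plane_closed _ HP' d f); auto. }
assert (k = h) as -> by incid. auto.
Qed.

(* Projecting moves the diagonal a2 a4 off the special line of e. *)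
Lemma special_diagonal_value d e f a1 a2 a3 a4 k : ~ sp d f -> conf d e f a1 a2 a3 a4 ->
  a2 <> D -> a4 <> D -> sp e a2 -> collinear d f k -> collinear a1 a3 k -> normal_value d e f k.
Proof.
intros ns C n2 n4 He Hk1 Hk2.
assert (exists P o c2 c4, plane P /\ P d /\ P f /\ P a1 /\ P a2 /\ P a3 /\ P a4 /\ ~ P o /\ o <> D /\
  ~ sp o a1 /\ ~ sp o a2 /\ ~ sp o a3 /\ ~ sp o a4 /\
  collinear o a2 c2 /\ c2 <> a2 /\ c2 <> o /\ ~ sp e c2 /\
  collinear o a4 c4 /\ collinear e c2 c4) as (P & o & c2 & c4 & K).
{ unfold conf in C. inc_conj.
  assert (d <> D) by incid. assert (e <> D) by incid. assert (f <> D) by incid.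
  assert (a1 <> D) by incid. assert (a3 <> D) by incid.
  assert (sp e a4) by incid. assert (~ sp d a2) by incid. assert (~ sp f a2) by incid.
  assert (~ sp f a4) by incid.
  destruct (span d f a2) as (P & HP & Pd & Pf & P2); auto.
  assert (Pe : P e) by (apply (plane_closed _ HP d f); auto; incid).
  assert (P1 : P a1) by (apply (plane_closed _ HP d a2); auto; incid).
  assert (P3 : P a3) by (apply (plane_closed _ HP f a2); auto; incid).
  assert (P4 : P a4) by (apply (plane_closed _ HP f a1); auto; incid).
  (* As e, a2, a4 share a special line, the centre avoids the special lines of all four vertices. *)
  destruct (fourth_fiber e a1 a3) as (t & nt & te & t1 & t3); auto.
  destruct (fiber_off_plane P t) as (o & no & Ho & noP); auto.
  assert (~ sp o e) by incid. assert (~ sp o a2) by incid. assert (~ sp o a4) by incid.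
  assert (o <> a2) by incid. destruct (third_point o a2) as (c2 & ? & ? & ?); auto.
  assert (~ sp e c2) by incid.
  assert (~ collinear o a2 e) by (apply (off_plane_noncollinear P); auto; incid).
  destruct (span o a2 e) as (B & HB & Bo & B2 & Be); auto.
  assert (Bc2 : B c2) by (apply (plane_closed _ HB o a2); auto).
  assert (B4 : B a4) by (apply (plane_collinear P B e a2); auto; incid).
  destruct (plane_inter B e c2 o a4) as (c4 & ? & ? & ?); [auto; incid .. |].
  exists P, o, c2, c4. split; auto. repeat split; auto; incid. }
apply (projected_value d e f a1 a2 a3 a4 k P o c2 c4); tauto.
Qed.

(* Projecting moves the vertex D to an ordinary point of the special line of o. *)
Lemma vertex_value d e f a2 a3 a4 k : ~ sp d f -> conf d e f D a2 a3 a4 ->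
  collinear d f k -> collinear D a3 k -> normal_value d e f k.
Proof.
intros ns C Hk1 Hk2.
pose proof C as (_ & _ & _ & C1 & C2 & C3 & C4 & C5).
assert (d <> e /\ d <> f /\ e <> f /\ collinear d e f /\ ~ collinear d f a2 /\ ~ collinear d f a3 /\
  ~ collinear d f a4 /\ a2 <> a4 /\ a2 <> D /\ a3 <> D /\ a4 <> D)
  as (nde & ndf & nef & H & k2 & k3 & k4 & n24 & n2 & n3 & n4).
{ unfold conf in C. inc_conj. repeat split; auto; incid. }
clear C.
assert (d <> D) by incid. assert (e <> D) by incid. assert (f <> D) by incid.
assert (~ sp e a2) by incid. assert (~ sp f a2) by incid. assert (~ sp d a4) by incid.
destruct (span d f a2) as (P & HP & Pd & Pf & P2); auto.
assert (Pe : P e) by (apply (plane_closed _ HP d f); auto; incid).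
assert (P4 : P a4) by (apply (plane_closed _ HP e a2); auto; incid).
assert (P3 : P a3) by (apply (plane_closed _ HP f a2); auto; incid).
(* With a1 = D, a2 is on the special line of d and a4 on that of f, so the centre avoids those of
   all ordinary vertices. *)
destruct (fourth_fiber d f a3) as (t & nt & td & tf & t3); auto.
destruct (fiber_off_plane P t) as (o & no & Ho & noP); auto.
assert (~ sp o d) by incid. assert (~ sp o f) by incid. assert (~ sp o a3) by incid.
assert (~ sp o a2) by incid. assert (~ sp o a4) by incid.
clear t nt td tf t3 Ho.
destruct (fourth_fiber o d e) as (t & nt & to & td & te); auto.
destruct (fiber_point o a2 t) as (c2 & Hc2 & Htc2 & nc2); auto.
assert (c2 <> o) by incid. assert (c2 <> a2) by incid. assert (~ sp e c2) by incid.
clear t nt to td te Htc2.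
assert (~ collinear o a2 e) by (apply (off_plane_noncollinear P); auto; incid).
assert (~ collinear o a2 d) by (apply (off_plane_noncollinear P); auto; incid).
assert (~ collinear o a4 f) by (apply (off_plane_noncollinear P); auto; incid).
assert (~ collinear o a4 a2) by (apply (off_plane_noncollinear P); auto; incid).
assert (exists c4, collinear e c2 c4 /\ collinear o a4 c4) as (c4 & Hc4 & Hc4').
{ destruct (span o a2 e) as (B & HB & Bo & B2 & Be); auto.
  assert (Bc2 : B c2) by (apply (plane_closed _ HB o a2); auto).
  assert (B4 : B a4) by (apply (plane_collinear P B e a2); auto; incid).
  destruct (plane_inter B e c2 o a4) as (c4 & ? & ? & ?); [auto; incid .. |]. exists c4; auto. }
assert (nPc2 : ~ P c2). { intro. apply noP, (plane_closed _ HP a2 c2); auto; incid. }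
assert (~ collinear d f c2). { intro. apply nPc2, (plane_closed _ HP d f); auto. }
destruct (span d f c2) as (P' & HP' & Pd' & Pf' & P2'); auto.
assert (noP' : ~ P' o).
{ intro. apply nPc2. rewrite (plane_eq P P' d f a2); auto.
  apply (plane_closed _ HP' o c2); auto; incid. }
assert (Pe' : P' e) by (apply (plane_closed _ HP' d f); auto; incid).
assert (P4' : P' c4) by (apply (plane_closed _ HP' e c2); auto).
assert (c4 <> a4).
{ intros ->. assert (P = P') by (apply (plane_eq P P' d f a4); auto). congruence. }
assert (nP4 : ~ P c4).
{ intro. apply noP, (plane_closed _ HP a4 c4); auto; incid. }
assert (~ collinear d f c4). { intro. apply nP4, (plane_closed _ HP d f); auto. }
destruct (desargues P P' o f d a2 a4 a3 c2 c4) as (c3 & P3' & ? & ? & ?); [auto; incid .. |].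
assert (~ sp f c4) by incid. assert (~ sp d c2) by incid.
assert (~ collinear d c2 f) by incid.
destruct (plane_inter P' d c2 f c4) as (c1 & P1' & ? & ?); [auto; incid .. |].
destruct (span o d a2) as (B & HB & Bo & Bd & B2); [auto; incid .. |].
assert (Bc2 : B c2) by (apply (plane_closed _ HB o a2); auto).
assert (Bc1 : B c1) by (apply (plane_closed _ HB d c2); auto).
(* The projected vertex c1 lies in the planes of o, d, a2 and of o, f, a4, which puts it on the
   special line of o. *)
assert (sp o c1).
{ destruct (span o f a4) as (C & HC & Co & Cf & C4'); [auto; incid .. |].
  assert (Cc4 : C c4) by (apply (plane_closed _ HC o a4); auto).
  assert (Cc1 : C c1) by (apply (plane_closed _ HC f c4); auto).
  apply (meet_in_fiber P B C o d a2 f a4); auto; incid. }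
assert (Cc : conf d e f c1 c2 c3 c4).
{ apply conf_intro; auto; incid. }
destruct (conf_meet d e f c1 c2 c3 c4) as (h & Hh1 & Hh2); auto.
assert (normal_value d e f h).
{ apply (ordinary_value d e f c1 c2 c3 c4); auto; apply (plane_ordinary _ HP'); auto. }
assert (n13 : c1 <> c3 /\ ~ collinear d f c3). { unfold conf in Cc. inc_conj. split; auto; incid. }
destruct n13 as [n13 k3'].
assert (Ph : P h) by (apply (plane_closed _ HP d f); auto).
assert (Ph' : P' h) by (apply (plane_closed _ HP' d f); auto).
(* If h and k differed, ha3 would be ordinary and meet the special line of o in a point x of P. The
   plane A contains o, c1 and x, so B, which contains o and c1, contains x too; then P and B share
   d, a2, x, hence P = B contains o. *)
destruct (classic (h = k)) as [<-|nhk]; auto. exfalso.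
assert (~ sp h a3) by incid.
assert (~ collinear o a3 h) by (apply (off_plane_noncollinear P); auto; incid).
destruct (span o a3 h) as (A & HA & Ao & A3 & Ah); auto. { apply (plane_ordinary _ HP); auto. }
assert (Ac3 : A c3) by (apply (plane_closed _ HA o a3); auto).
assert (Ac1 : A c1) by (apply (plane_collinear P' A h c3); auto; incid).
destruct (fiber_point h a3 o) as (x & ? & ? & ?); auto.
assert (Ax : A x) by (apply (plane_closed _ HA h a3); auto).
assert (Px : P x) by (apply (plane_closed _ HP h a3); auto).
assert (Bx : B x).
{ apply (plane_special A B o c1); auto. intros ->; auto. }
apply noP. rewrite (plane_eq P B d a2 x); auto. incid.
Qed.

Lemma conf_value d e f a1 a2 a3 a4 k : ~ sp d f -> conf d e f a1 a2 a3 a4 ->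
  collinear d f k -> collinear a1 a3 k -> normal_value d e f k.
Proof.
intros ns C Hk1 Hk2. assert (Hk3 : collinear a3 a1 k) by incid.
pose proof (conf_rot _ _ _ _ _ _ _ C) as C'.
destruct (classic (a2 = D)) as [->|].
{ intros c1 c3 c4 h ? ? ?. apply (normal_unique d e f c1 c3 c4 a1 a3 a4); auto. }
destruct (classic (a4 = D)) as [->|].
{ intros c1 c3 c4 h ? ? ?. apply (normal_unique d e f c1 c3 c4 a3 a1 a2); auto. }
destruct (classic (a1 = D)) as [->|]. { apply (vertex_value d e f a2 a3 a4); auto. }
destruct (classic (a3 = D)) as [->|]. { apply (vertex_value d e f a4 a1 a2); auto. }
destruct (classic (sp e a2)).
- apply (special_diagonal_value d e f a1 a2 a3 a4); auto.
- apply (ordinary_value d e f a1 a2 a3 a4); auto.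
Qed.

End FourFibers.

(** * Special base line: comparing configurations in different planes *)

(** This is [desargues] with D in place of d. If p'r' were ordinary, it would meet the special line
    of f in a point w of both planes; the plane of o, p, r would share p, r, w with P and so equal
    P, which misses o. *)
Lemma desargues_special P P' o f p q r p' q' : plane P -> plane P' -> ~ P o -> ~ P' o -> o <> D ->
  (forall w, sp f w -> P' w -> P w) -> P f -> P' f ->
  P p -> P q -> P r -> P' p' -> P' q' ->
  sp p r -> p <> r -> ~ sp f p -> collinear f q r -> ~ sp f q ->
  ~ sp o p -> ~ sp o q -> collinear o p p' -> collinear o q q' ->
  exists r', P' r' /\ collinear o r r' /\ collinear f q' r' /\ sp p' r'.
Proof.
intros HP HP' no no' oD Hw Pf Pf' Pp Pq Pr Pp' Pq' Hpr npr nfp Hr nfq nop noq Hp' Hq'.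
pose proof (plane_ordinary _ HP _ Pp). pose proof (plane_ordinary _ HP _ Pq).
pose proof (plane_ordinary _ HP _ Pr). pose proof (plane_ordinary _ HP _ Pf).
assert (~ sp o r) by incid. assert (q' <> o) by (intros ->; auto).
assert (~ collinear o q f) by (apply (off_plane_noncollinear P); auto; incid).
assert (~ collinear o p r) by (apply (off_plane_noncollinear P); auto).
destruct (span o q f) as (B & HB & Bo & Bq & Bf); auto.
assert (Bq' : B q') by (apply (plane_closed _ HB o q); auto).
assert (Br : B r) by (apply (plane_closed _ HB f q); auto).
assert (~ collinear o q' f) by (apply (off_plane_noncollinear P'); auto; incid).
destruct (plane_inter B f q' o r) as (r' & Br' & ? & ?); [auto; incid .. |].
assert (Pr' : P' r') by (apply (plane_collinear B P' f q'); auto; incid).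
exists r'. split; auto. split; auto. split; auto.
apply NNPP; intro n.
assert (~ sp p' r').
{ pose proof (plane_ordinary _ HP' _ Pp'). pose proof (plane_ordinary _ HP' _ Pr'). incid. }
destruct (fiber_point p' r' f) as (w & ? & ? & ?); auto.
assert (Pw' : P' w) by (apply (plane_closed _ HP' p' r'); auto).
assert (Pw : P w) by auto.
destruct (span o p r) as (C & HC & Co & Cp & Cr); auto.
assert (Cp' : C p') by (apply (plane_closed _ HC o p); auto).
assert (Cr' : C r') by (apply (plane_closed _ HC o r); auto).
assert (Cw : C w) by (apply (plane_closed _ HC p' r'); auto).
apply no. rewrite (plane_eq P C p r w); auto. incid.
Qed.

Lemma exists_off_fiber p : p <> D -> exists t, t <> D /\ ~ sp p t.
Proof.
intro np. destruct (pr_A2 _ _ PR) as (a & b & c & _ & _ & n & _).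
assert (~ (sp p a /\ sp p b /\ sp p c)) by (intros (? & ? & ?); incid).
destruct (classic (sp p a)), (classic (sp p b)), (classic (sp p c));
 solve [tauto | exists a; split; auto; incid | exists b; split; auto; incid | exists c; split; auto; incid].
Qed.

Lemma plane_through e f : e <> D -> f <> D -> e <> f -> sp e f ->
  exists P, plane P /\ P e /\ P f.
Proof.
intros ne nf n H. destruct (exists_off_fiber e) as (t & ? & ?); auto.
destruct (span e f t) as (P & ? & ? & ? & ?); [auto; incid .. |]. exists P; auto.
Qed.

Lemma other_plane P e f : ~ projective_plane S -> plane P -> P e -> P f -> e <> f -> sp e f ->
  exists P', P <> P' /\ plane P' /\ P' e /\ P' f.
Proof.
intros NT HP Pe Pf n H.
pose proof (plane_ordinary _ HP _ Pe). pose proof (plane_ordinary _ HP _ Pf).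
destruct (exists_off_fiber e) as (t & ? & ?); auto.
destruct (fiber_off_plane P t) as (o & ? & ? & ?); auto.
destruct (span e f o) as (P' & ? & ? & ? & ?); [auto; incid .. |].
exists P'. split; [congruence | auto].
Qed.

(* In [R P x y h], x and y stand for the two special lines of a configuration in P
   and h for its harmonic point. *)
Lemma fiber_chain (ok : (point S -> Prop) -> Prop) (s : point S)
    (R : (point S -> Prop) -> point S -> point S -> point S -> Prop) :
  four_fibers -> s <> D ->
  (forall P, ok P -> exists P', P <> P' /\ ok P') ->
  (forall P x y, ok P -> x <> D -> y <> D -> ~ sp s x -> ~ sp s y -> ~ sp x y ->
     exists h, R P x y h) ->
  (forall P x y h, R P x y h -> x <> D /\ y <> D /\ ~ sp s x /\ ~ sp s y /\ ~ sp x y) ->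
  (forall P P' x y x' y' h h', ok P -> ok P' -> P <> P' -> ~ sp x x' -> ~ sp y y' ->
     R P x y h -> R P' x' y' h' -> h = h') ->
  forall P P' x y x' y' h h', ok P -> ok P' -> R P x y h -> R P' x' y' h' -> h = h'.
Proof.
intros F ns Oth Ex Val Cmp.
(* Configurations sharing a plane and x are both compared with one in another plane, on z and x. *)
assert (E1 : forall P x y y' h h', ok P -> R P x y h -> R P x y' h' -> h = h').
{ intros P x y y' h h' okP H H'.
  destruct (Val _ _ _ _ H) as (? & ? & ? & ? & ?), (Val _ _ _ _ H') as (? & ? & ? & ? & ?).
  destruct (Oth P okP) as (P' & nP & okP'). destruct (F s x x) as (z & ? & ? & ? & _); auto.
  destruct (Ex P' z x) as (g & G); [auto; incid .. |].
  transitivity g; [apply (Cmp P P' x y z x) | symmetry; apply (Cmp P P' x y' z x)]; auto; incid. }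
assert (E2 : forall P x x' y h h', ok P -> R P x y h -> R P x' y h' -> h = h').
{ intros P x x' y h h' okP H H'.
  destruct (Val _ _ _ _ H) as (? & ? & ? & ? & ?), (Val _ _ _ _ H') as (? & ? & ? & ? & ?).
  destruct (Oth P okP) as (P' & nP & okP'). destruct (F s y y) as (z & ? & ? & ? & _); auto.
  destruct (Ex P' y z) as (g & G); auto.
  transitivity g; [apply (Cmp P P' x y y z) | symmetry; apply (Cmp P P' x' y y z)]; auto; incid. }
(* One special line is changed at a time, through a z off those of s, x and x'. *)
assert (E3 : forall P x y x' y' h h', ok P -> R P x y h -> R P x' y' h' -> h = h').
{ intros P x y x' y' h h' okP H H'.
  destruct (Val _ _ _ _ H) as (? & ? & ? & ? & ?), (Val _ _ _ _ H') as (? & ? & ? & ? & ?).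
  destruct (F s x x') as (z & ? & ? & ? & ?); auto.
  destruct (Ex P x z) as (g & G); auto. destruct (Ex P x' z) as (g' & G'); auto.
  transitivity g; [eauto|]. transitivity g'; eauto. }
intros P P' x y x' y' h h' okP okP' H H'.
destruct (classic (P = P')) as [<-|nP]; [eauto|].
destruct (Val _ _ _ _ H) as (? & ? & ? & ? & ?).
(* Exchanging x and y makes both special lines differ from those of the first configuration. *)
destruct (Ex P' y x) as (g & G); [auto; incid .. |].
transitivity g; eauto. apply (Cmp P P' x y y x); auto; incid.
Qed.

(** The lines a2 a4 and c2 c4 meet in e, so Pasch gives a centre o on a2 c2 and a4 c4.
    [desargues_special] then carries a1 to c1 and a3 to c3. *)
Lemma tip_compare e f a1 a2 a3 a4 c1 c2 c3 c4 P P' h k : e <> D -> f <> D ->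
  conf D e f a1 a2 a3 a4 -> conf D e f c1 c2 c3 c4 ->
  plane P -> P e -> P f -> P a4 -> plane P' -> P' e -> P' f -> P' c4 -> P <> P' ->
  ~ sp a2 c2 -> ~ sp a4 c4 ->
  sp f h -> collinear a1 a3 h -> sp f k -> collinear c1 c3 k -> h = k.
Proof.
intros ne nf Ca Cc HP Pe Pf P4 HP' Pe' Pf' P4' nP n2 n4 Hh1 Hh2 Hk1 Hk2.
assert (Hef : sp e f /\ e <> f) by (unfold conf in Ca; inc_conj; split; incid).
destruct Hef as [Hef nef].
assert (W : forall a1 a2 a3 a4 P, conf D e f a1 a2 a3 a4 -> plane P -> P e -> P f -> P a4 ->
  P a1 /\ P a2 /\ P a3 /\ ~ sp f a2 /\ ~ sp f a4 /\ ~ sp f a1 /\ ~ sp f a3 /\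
  collinear e a2 a4 /\ ~ sp a2 a4 /\ ~ sp a1 a3 /\
  sp a2 a1 /\ sp a4 a3 /\ collinear f a4 a1 /\ collinear f a2 a3 /\ a2 <> a1 /\ a4 <> a3).
{ clear - PR ne nf Hef. intros a1 a2 a3 a4 P C HP Pe Pf P4. unfold conf in C. inc_conj.
  assert (~ sp e a4) by incid.
  assert (P2 : P a2) by (apply (plane_closed _ HP e a4); auto).
  assert (P1 : P a1) by (apply (plane_closed _ HP f a4); auto).
  assert (P3 : P a3) by (apply (plane_closed _ HP f a2); auto; incid).
  assert (~ sp a2 a4) by incid.
  repeat split; auto; incid. }
destruct (W _ _ _ _ _ Ca HP Pe Pf P4) as (P1 & P2 & P3 & A1 & A2 & A3 & A4 & A5 & A6 & A7 & A8 & A9 &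
  A10 & A11 & A12 & A13).
destruct (W _ _ _ _ _ Cc HP' Pe' Pf' P4') as (P1' & P2' & P3' & C1 & C2 & C3 & C4 & C5 & C6 & C7 & C8 & C9 &
  C10 & C11 & C12 & C13).
clear W Ca Cc.
assert (K : forall w, P w -> P' w -> sp f w).
{ intros w ? ?. assert (collinear e f w) by (apply (plane_common P P'); auto). incid. }
assert (K' : forall w, sp f w -> P' w -> P w).
{ intros w ? ?. apply (plane_special P' P f e); auto; incid. }
assert (nP2 : ~ P c2). { intro X. specialize (K _ X P2'). incid. }
assert (nP4 : ~ P c4). { intro X. specialize (K _ X P4'). incid. }
assert (nP2' : ~ P' a2). { intro X. specialize (K _ P2 X). incid. }
assert (nP4' : ~ P' a4). { intro X. specialize (K _ P4 X). incid. }
assert (forall w, collinear a2 a4 w -> P w) by (intros; apply (plane_closed _ HP a2 a4); auto).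
destruct (pasch e a2 a4 c2 c4) as (o & Ho2 & Ho4); [auto; incid .. |].
assert (no : o <> D) by incid.
assert (noP : ~ P o).
{ intro. destruct (classic (o = a2)) as [->|].
  - apply nP4, (plane_closed _ HP a2 a4); auto; incid.
  - apply nP2, (plane_closed _ HP a2 o); auto; incid. }
assert (noP' : ~ P' o).
{ intro. destruct (classic (o = c2)) as [->|].
  - apply nP4', (plane_closed _ HP' c2 c4); auto; incid.
  - apply nP2', (plane_closed _ HP' c2 o); auto; incid. }
assert (~ sp o a2) by incid. assert (~ sp o a4) by incid.
destruct (desargues_special P P' o f a2 a4 a1 c2 c4) as (b1 & Pb1 & ? & ? & ?); [auto; incid .. |].
assert (b1 = c1) as -> by (pose proof (plane_ordinary _ HP' _ Pb1); incid).
destruct (desargues_special P P' o f a4 a2 a3 c4 c2) as (b3 & Pb3 & ? & ? & ?); [auto; incid .. |].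
assert (b3 = c3) as -> by (pose proof (plane_ordinary _ HP' _ Pb3); incid).
pose proof (plane_ordinary _ HP _ P1). pose proof (plane_ordinary _ HP _ P3).
assert (~ sp o a1) by incid. assert (~ sp o a3) by incid.
assert (~ collinear o a1 a3) by (apply (off_plane_noncollinear P); auto; incid).
destruct (span o a1 a3) as (A & HA & Ao & Aa1 & Aa3); auto.
assert (Ph : P h) by (apply (plane_closed _ HP a1 a3); auto).
assert (Pk' : P' k) by (apply (plane_closed _ HP' c1 c3); auto).
assert (Hhk : collinear a1 h k).
{ apply (conjugate_unique P P' A o a1 a3 c1 c3); auto; try incid.
  - apply (plane_closed _ HA o a1); auto.
  - apply (plane_closed _ HA o a3); auto. }
clear - PR Hhk Hh1 Hk1 A3 nf. incid.
Qed.

(** The centre o comes from the lines a1 a2 and c1 c2, which meet in d. The line a1 a3 may be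
    special, so the value D is treated separately. *)
Lemma middle_compare d f a1 a2 a3 a4 c1 c2 c3 c4 P P' h k : d <> D -> f <> D ->
  conf d D f a1 a2 a3 a4 -> conf d D f c1 c2 c3 c4 ->
  plane P -> P d -> P f -> P a2 -> plane P' -> P' d -> P' f -> P' c2 -> P <> P' ->
  ~ sp a2 c2 -> ~ sp a1 c1 ->
  sp f h -> collinear a1 a3 h -> sp f k -> collinear c1 c3 k -> h = k.
Proof.
intros nd nf Ca Cc HP Pd Pf P2 HP' Pd' Pf' P2' nP n2 n1 Hh1 Hh2 Hk1 Hk2.
assert (Hdf : sp d f /\ d <> f) by (unfold conf in Ca; inc_conj; split; incid).
destruct Hdf as [Hdf ndf].
assert (W : forall a1 a2 a3 a4 P, conf d D f a1 a2 a3 a4 -> plane P -> P d -> P f -> P a2 ->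
  P a1 /\ P a3 /\ P a4 /\ ~ sp f a2 /\ ~ sp f a4 /\ ~ sp f a1 /\ ~ sp f a3 /\ sp a2 a4 /\
  a2 <> a4 /\ a1 <> a3 /\ ~ sp a1 a2 /\ collinear d a1 a2 /\ collinear d a4 a3 /\
  collinear f a4 a1 /\ collinear f a2 a3).
{ clear - PR nd nf Hdf. intros a1 a2 a3 a4 P C HP Pd Pf P2. unfold conf in C. inc_conj.
  assert (~ sp f a2) by incid. assert (~ sp d a2) by incid. assert (~ sp f a1) by incid.
  assert (P1 : P a1) by (apply (plane_closed _ HP d a2); auto; incid).
  assert (P3 : P a3) by (apply (plane_closed _ HP f a2); auto; incid).
  assert (P4 : P a4) by (apply (plane_closed _ HP f a1); auto; incid).
  repeat split; auto; incid. }
destruct (W _ _ _ _ _ Ca HP Pd Pf P2) as (P1 & P3 & P4 & A1 & A2 & A3 & A4 & A5 & A6 & A7 & A8 & A9 &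
  A10 & A11 & A12).
destruct (W _ _ _ _ _ Cc HP' Pd' Pf' P2') as (P1' & P3' & P4' & C1 & C2 & C3 & C4 & C5 & C6 & C7 & C8 & C9 &
  C10 & C11 & C12).
clear W Ca Cc.
assert (K : forall w, P w -> P' w -> sp f w).
{ intros w ? ?. assert (collinear d f w) by (apply (plane_common P P'); auto). incid. }
assert (K' : forall w, sp f w -> P' w -> P w).
{ intros w ? ?. apply (plane_special P' P f d); auto; incid. }
assert (nP2 : ~ P c2). { intro X. specialize (K _ X P2'). incid. }
assert (nP1 : ~ P c1). { intro X. specialize (K _ X P1'). incid. }
assert (nP2' : ~ P' a2). { intro X. specialize (K _ P2 X). incid. }
assert (nP1' : ~ P' a1). { intro X. specialize (K _ P1 X). incid. }
assert (nP3' : ~ P' a3). { intro X. specialize (K _ P3 X). incid. }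
assert (a1 <> D /\ a2 <> D /\ a3 <> D /\ a4 <> D) as (D1 & D2 & D3 & D4)
  by (repeat split; apply (plane_ordinary _ HP); auto).
assert (c1 <> D /\ c2 <> D /\ c3 <> D /\ c4 <> D) as (E1 & E2 & E3 & E4)
  by (repeat split; apply (plane_ordinary _ HP'); auto).
assert (~ collinear a2 a1 c2). { intro. apply nP2, (plane_closed _ HP a2 a1); auto; incid. }
assert (~ collinear a2 a1 c1). { intro. apply nP1, (plane_closed _ HP a2 a1); auto; incid. }
destruct (pasch d a2 a1 c2 c1) as (o & Ho2 & Ho1); [auto; incid .. |].
assert (no : o <> D) by incid.
assert (noP : ~ P o).
{ intro. destruct (classic (o = a2)) as [->|].
  - apply nP1, (plane_closed _ HP a2 a1); auto; incid.
  - apply nP2, (plane_closed _ HP a2 o); auto; incid. }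
assert (noP' : ~ P' o).
{ intro. destruct (classic (o = c2)) as [->|].
  - apply nP1', (plane_closed _ HP' c2 c1); auto; incid.
  - apply nP2', (plane_closed _ HP' c2 o); auto; incid. }
assert (~ sp o a2) by incid. assert (~ sp o a1) by incid. assert (~ sp o a4) by incid.
destruct (desargues_special P P' o f a2 a1 a4 c2 c1) as (b4 & Pb4 & Hb4 & Hb4' & Hb4'');
  [auto; incid .. |].
assert (b4 = c4) as ->.
{ pose proof (plane_ordinary _ HP' _ Pb4). clear - PR H1 E2 C1 C3 C5 C11 Hb4' Hb4''. incid. }
assert (~ collinear o a4 d) by (apply (off_plane_noncollinear P); auto; incid).
assert (~ collinear o a2 f) by (apply (off_plane_noncollinear P); auto; incid).
assert (~ collinear o a1 a3) by (apply (off_plane_noncollinear P); auto).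
destruct (span o a4 d) as (E & HE & Eo & E4' & Ed); auto.
destruct (span o a2 f) as (F & HF & Fo & F2 & Ff); auto.
destruct (span o a1 a3) as (A & HA & Ao & A1' & A3'); auto.
assert (~ sp d a4) by (clear - PR Hdf nf nd A2; incid).
assert (~ sp d c4) by (clear - PR Hdf nf nd C2; incid).
assert (Ec4 : E c4) by (apply (plane_closed _ HE o a4); auto).
assert (Ea3 : E a3) by (apply (plane_closed _ HE d a4); auto).
assert (Ec3 : E c3) by (apply (plane_closed _ HE d c4); auto).
assert (Fc2 : F c2) by (apply (plane_closed _ HF o a2); auto; incid).
assert (Fa3 : F a3) by (apply (plane_closed _ HF f a2); auto).
assert (Fc3 : F c3) by (apply (plane_closed _ HF f c2); auto).
(* The planes of o, a4, d and of o, a2, f are distinct and both contain a3 and c3. *)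
assert (Ho3 : collinear o a3 c3).
{ apply (plane_common E F); auto. intros <-. apply noP. rewrite (plane_eq P E d f a4); auto.
  clear - PR Hdf nf nd ndf A2. incid. }
assert (Ac1 : A c1) by (apply (plane_closed _ HA o a1); auto; incid).
assert (Ac3 : A c3) by (apply (plane_collinear E A o a3); auto; incid).
(* If h is D and k is not, then k is a point of both P and A off the line a1 a3, so P = A would
   contain o. *)
assert (Sym : forall P P' a1 a3 c1 c3 h k, plane P -> plane P' -> P a1 -> P a3 -> P' c1 -> P' c3 ->
  A a1 -> A a3 -> A c1 -> A c3 -> a1 <> a3 -> c1 <> c3 -> ~ P o -> ~ sp f a1 -> ~ sp f c1 ->
  (forall w, sp f w -> P' w -> P w) -> sp f h -> sp f k -> collinear a1 a3 h -> collinear c1 c3 k ->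
  h = D -> k = D).
{ clear - PR HA Ao nf. intros P P' a1 a3 c1 c3 h k HP HP' P1 P3 P1' P3' A1 A3 A1' A3' na nc noP s1 s1' K'
    Hh Hk Hh' Hk' ->. apply NNPP; intro nk. apply noP.
  pose proof (plane_ordinary _ HP' _ P1'). pose proof (plane_ordinary _ HP _ P1).
  assert (~ sp c1 c3) by incid.
  assert (A k) by (apply (plane_closed _ HA c1 c3); auto).
  assert (P k) by (apply K'; auto; apply (plane_closed _ HP' c1 c3); auto).
  rewrite (plane_eq P A a1 a3 k); auto. incid. }
assert (K'' : forall w, sp f w -> P w -> P' w).
{ intros w ? ?. apply (plane_special P P' f d); auto; incid. }
destruct (classic (h = D)) as [Eh|nh].
{ rewrite (Sym P P' a1 a3 c1 c3 h k); auto. }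
destruct (classic (k = D)) as [Ek|nk].
{ rewrite (Sym P' P c1 c3 a1 a3 k h); auto. }
assert (~ sp a1 a3) by (clear - PR nh D1 D3 A3 A7 Hh1 Hh2 nf; incid).
assert (~ sp c1 c3) by (clear - PR nk E1 E3 C3 C7 Hk1 Hk2 nf; incid).
assert (Ph : P h) by (apply (plane_closed _ HP a1 a3); auto).
assert (Pk' : P' k) by (apply (plane_closed _ HP' c1 c3); auto).
assert (Hhk : collinear a1 h k).
{ apply (conjugate_unique P P' A o a1 a3 c1 c3); auto. }
clear - PR Hhk Hh1 Hk1 A3 nf. incid.
Qed.

(** * Existence and uniqueness of the conjugate, with few or many special lines *)

Definition has_conjugate d e f : Prop :=
  (exists a1 a2 a3 a4, conf d e f a1 a2 a3 a4) /\
  exists h, forall a1 a2 a3 a4, conf d e f a1 a2 a3 a4 -> collinear d f h /\ collinear a1 a3 h.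

Lemma has_conjugate_swap d e f : has_conjugate d e f -> has_conjugate f e d.
Proof.
intros ((a1 & a2 & a3 & a4 & C) & h & H). split.
- exists a3, a2, a1, a4. apply conf_swap; auto.
- exists h. intros b1 b2 b3 b4 B. apply conf_swap in B. specialize (H _ _ _ _ B). incid.
Qed.

Lemma has_conjugate_harmonic d e f : has_conjugate d e f ->
  exists h, is_harmonic_conjugate d e f h.
Proof.
intros ((a1 & a2 & a3 & a4 & C) & h & H). exists h.
pose proof C as ((_ & n & _ & l & Hd & He & Hf) & _). exists l. split; auto. split.
- exists a1, a2, a3, a4. apply conf_iff; auto.
- intros b1 b2 b3 b4 B. apply conf_iff in B; auto.
  destruct (H _ _ _ _ B) as ((l' & ? & ? & ?) & m & ? & ? & ?).
  exists m. rewrite (line_unique d f l l'); auto.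
Qed.

Lemma has_conjugate_intro d e f : (exists a1 a2 a3 a4, conf d e f a1 a2 a3 a4) ->
  (forall a1 a2 a3 a4, conf d e f a1 a2 a3 a4 -> exists h, collinear d f h /\ collinear a1 a3 h) ->
  (forall a1 a2 a3 a4 c1 c2 c3 c4 h k, conf d e f a1 a2 a3 a4 -> conf d e f c1 c2 c3 c4 ->
     collinear d f h -> collinear a1 a3 h -> collinear d f k -> collinear c1 c3 k -> h = k) ->
  has_conjugate d e f.
Proof.
intros Ex Me Un. split; auto. destruct Ex as (a1 & a2 & a3 & a4 & C).
destruct (Me _ _ _ _ C) as (h & Hh & Hh'). exists h. intros b1 b2 b3 b4 B.
destruct (Me _ _ _ _ B) as (k & Hk & Hk').
rewrite (Un a1 a2 a3 a4 b1 b2 b3 b4 h k); auto.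
Qed.

(** The points x and y prescribe the special line of a1, a2 and that of a3, a4, by which
    [fiber_chain] indexes configurations. *)
Lemma tip_conf P e f x y : plane P -> P e -> P f -> e <> f -> sp e f ->
  x <> D -> y <> D -> ~ sp f x -> ~ sp f y -> ~ sp x y ->
  exists a1 a2 a3 a4 h, conf D e f a1 a2 a3 a4 /\ P a4 /\ sp x a2 /\ sp y a4 /\
    sp f h /\ collinear a1 a3 h.
Proof.
intros HP Pe Pf n H nx ny sx sy sxy.
pose proof (plane_ordinary _ HP _ Pe). pose proof (plane_ordinary _ HP _ Pf).
destruct (plane_fiber P y) as (a4 & P4 & H4); auto.
pose proof (plane_ordinary _ HP _ P4).
destruct (fiber_point e a4 x) as (a2 & ? & ? & ?); [auto; incid .. |].
destruct (fiber_point f a4 x) as (a1 & ? & ? & ?); [auto; incid .. |].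
destruct (fiber_point f a2 y) as (a3 & ? & ? & ?); [auto; incid .. |].
destruct (fiber_point a1 a3 f) as (h & ? & ? & ?); [auto; incid .. |].
exists a1, a2, a3, a4, h. split; [apply conf_intro; auto; incid | auto 10].
Qed.

(** Here x prescribes the special line of a2 and a4, and y that of a1. The ordinary lines da4 and
    fa2 meet because they belong to P. *)
Lemma middle_conf P d f x y : plane P -> P d -> P f -> d <> f -> sp d f ->
  x <> D -> y <> D -> ~ sp f x -> ~ sp f y -> ~ sp x y ->
  exists a1 a2 a3 a4 h, conf d D f a1 a2 a3 a4 /\ P a2 /\ sp x a2 /\ sp y a1 /\
    sp f h /\ collinear a1 a3 h.
Proof.
intros HP Pd Pf n H nx ny sx sy sxy.
pose proof (plane_ordinary _ HP _ Pd). pose proof (plane_ordinary _ HP _ Pf).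
destruct (plane_fiber P x) as (a2 & P2 & H2); auto.
pose proof (plane_ordinary _ HP _ P2).
assert (~ sp d a2) by incid. assert (~ sp f a2) by incid.
destruct (fiber_point d a2 y) as (a1 & ? & ? & ?); auto.
assert (P1 : P a1) by (apply (plane_closed _ HP d a2); auto).
assert (~ sp f a1) by incid.
destruct (fiber_point f a1 x) as (a4 & ? & ? & ?); auto.
assert (P4 : P a4) by (apply (plane_closed _ HP f a1); auto).
assert (~ sp d a4) by incid.
destruct (plane_meet _ HP d a4 f a2) as (a3 & ? & ?); auto.
assert (a2 <> a4) by incid.
assert (exists h, sp f h /\ collinear a1 a3 h) as (h & ? & ?).
{ destruct (classic (sp a1 a3)). { exists D; split; incid. }
  destruct (fiber_point a1 a3 f) as (h & ? & ? & ?); auto. exists h; auto. }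
exists a1, a2, a3, a4, h. split; [apply conf_intro; auto; incid | auto 10].
Qed.

Lemma conf_special_meet d e f a1 a2 a3 a4 : conf d e f a1 a2 a3 a4 -> sp d f ->
  exists h, collinear d f h /\ collinear a1 a3 h.
Proof.
intros C H. unfold conf in C. inc_conj.
destruct (classic (sp a1 a3)). { exists D; split; incid. }
destruct (classic (d = D)) as [->|].
- destruct (fiber_point a1 a3 f) as (h & ? & ? & ?); [auto; incid .. |]. exists h; split; incid.
- destruct (fiber_point a1 a3 d) as (h & ? & ? & ?); [auto; incid .. |]. exists h; split; incid.
Qed.

Lemma ordinary_conjugate d e f : ~ projective_plane S -> d <> e -> d <> f -> e <> f ->
  collinear d e f -> ~ sp d f -> has_conjugate d e f.
Proof.
intros NT nde ndf nef H ns.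
assert (nd : d <> D) by incid. assert (ne : e <> D) by incid. assert (nf : f <> D) by incid.
assert (exists c1 c3 c4, conf d e f c1 D c3 c4) as (c1 & c3 & c4 & C).
{ destruct (third_point D e) as (c4 & ? & ? & ?); auto.
  destruct (normal_exists d e f c4) as (c1 & c3 & C); auto. exists c1, c3, c4; auto. }
apply has_conjugate_intro.
- exists c1, D, c3, c4; auto.
- intros. apply (conf_meet d e f a1 a2 a3 a4); auto.
- destruct (classic four_fibers) as [F|F].
  + destruct (conf_meet d e f c1 D c3 c4) as (g & ? & ?); auto.
    intros a1 a2 a3 a4 b1 b2 b3 b4 h k Ca Cb ? ? ? ?. transitivity g.
    * symmetry. apply (conf_value NT F d e f a1 a2 a3 a4 h ns Ca) with c1 c3 c4; auto.
    * apply (conf_value NT F d e f b1 b2 b3 b4 k ns Cb) with c1 c3 c4; auto.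
  (* With only three special lines the line df has just the points d, e, f, and h = d or h = f would
     make three vertices collinear. *)
  + assert (W : forall a1 a2 a3 a4 h, conf d e f a1 a2 a3 a4 -> collinear d f h ->
      collinear a1 a3 h -> h = e).
    { intros a1 a2 a3 a4 h Ca ? ?. unfold conf in Ca. inc_conj.
      assert (h <> D) by incid.
      destruct (three_fibers d e f h) as [|[|]]; [auto; incid .. | | |].
      - assert (h = d) by incid. subst h. exfalso; incid.
      - incid.
      - assert (h = f) by incid. subst h. exfalso; incid. }
    intros a1 a2 a3 a4 b1 b2 b3 b4 h k Ca Cb ? ? ? ?.
    rewrite (W a1 a2 a3 a4 h), (W b1 b2 b3 b4 k); auto.
Qed.

Lemma tip_conjugate e f : ~ projective_plane S -> e <> D -> f <> D -> e <> f ->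
  sp e f -> has_conjugate D e f.
Proof.
intros NT ne nf nef H.
destruct (plane_through e f) as (P0 & HP0 & Pe0 & Pf0); auto.
apply has_conjugate_intro.
- destruct (exists_off_fiber f) as (x & ? & ?); auto.
  destruct (third_point f x) as (y & ? & ? & ?); [incid|].
  destruct (tip_conf P0 e f x y) as (a1 & a2 & a3 & a4 & _ & C & _); [auto; incid .. |].
  exists a1, a2, a3, a4; auto.
- intros. apply (conf_special_meet D e f a1 a2 a3 a4); auto. incid.
- destruct (classic four_fibers) as [F|F].
  + set (ok := fun P => plane P /\ P e /\ P f).
    set (R := fun (P : point S -> Prop) x y h => exists a1 a2 a3 a4, conf D e f a1 a2 a3 a4 /\ P a4 /\
      sp x a2 /\ sp y a4 /\ sp f h /\ collinear a1 a3 h /\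
      (x <> D /\ y <> D /\ ~ sp f x /\ ~ sp f y /\ ~ sp x y)).
    assert (K : forall P P' x y x' y' h h', ok P -> ok P' -> R P x y h -> R P' x' y' h' -> h = h').
    { apply (fiber_chain ok f R); auto.
      - intros P (? & ? & ?). apply other_plane; auto.
      - intros P x y (? & ? & ?) ? ? ? ? ?.
        destruct (tip_conf P e f x y) as (a1 & a2 & a3 & a4 & h & ?); auto.
        exists h, a1, a2, a3, a4. tauto.
      - intros P x y h (a1 & a2 & a3 & a4 & ?). tauto.
      - intros P P' x y x' y' h k (? & ? & ?) (? & ? & ?) ? nx ny
          (a1 & a2 & a3 & a4 & Ca & ? & ? & ? & ? & ? & ? & ? & _)
          (b1 & b2 & b3 & b4 & Cb & ? & ? & ? & ? & ? & ? & ? & _).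
        assert (a2 <> D /\ a4 <> D) by (unfold conf in Ca; inc_conj; split; incid).
        assert (b2 <> D /\ b4 <> D) by (unfold conf in Cb; inc_conj; split; incid).
        apply (tip_compare e f a1 a2 a3 a4 b1 b2 b3 b4 P P'); auto;
          clear Ca Cb; incid. }
    assert (W : forall a1 a2 a3 a4 h, conf D e f a1 a2 a3 a4 -> sp f h -> collinear a1 a3 h ->
      exists P, ok P /\ R P a2 a4 h).
    { intros a1 a2 a3 a4 h C ? ?. pose proof C as C'. unfold conf in C'. inc_conj.
      destruct (span e f a4) as (P & ? & ? & ? & ?); [auto; incid .. |].
      exists P. split; [split; auto|]. exists a1, a2, a3, a4.
      assert (a2 <> D) by incid. assert (a4 <> D) by incid.
      repeat split; auto; incid. }
    intros a1 a2 a3 a4 b1 b2 b3 b4 h k Ca Cb ? ? ? ?.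
    destruct (W a1 a2 a3 a4 h) as (P & ? & ?); auto.
    destruct (W b1 b2 b3 b4 k) as (P' & ? & ?); auto.
    apply (K P P' a2 a4 b2 b4); auto.
  + assert (W : forall a1 a2 a3 a4 h, conf D e f a1 a2 a3 a4 -> sp f h ->
      collinear a1 a3 h -> h = e).
    { intros a1 a2 a3 a4 h Ca ? ?. unfold conf in Ca. inc_conj.
      assert (~ sp f a2) by incid. assert (~ sp a2 a4) by incid. assert (a2 <> D) by incid. assert (a4 <> D) by incid.
      (* With three special lines, the point x of a1 e and f a2 can only be on that of a4, so x = a3
         and a1 a3 passes through e. *)
      destruct (pasch a4 a1 f e a2) as (x & ? & ?); [auto; incid .. |].
      assert (x <> D) by incid.
      destruct (three_fibers f a2 a4 x) as [|[|]]; [auto; incid .. | | |].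
      - exfalso. assert (x = f) by incid. subst x. incid.
      - exfalso. assert (x = a2) by incid. subst x. incid.
      - assert (x = a3) by incid. subst x. incid. }
    intros a1 a2 a3 a4 b1 b2 b3 b4 h k Ca Cb ? ? ? ?.
    rewrite (W a1 a2 a3 a4 h), (W b1 b2 b3 b4 k); auto.
Qed.

Lemma middle_conjugate d f : ~ projective_plane S -> d <> D -> f <> D -> d <> f ->
  sp d f -> has_conjugate d D f.
Proof.
intros NT nd nf ndf H.
destruct (plane_through d f) as (P0 & HP0 & Pd0 & Pf0); auto.
assert (Hdf : forall h, collinear d f h <-> sp f h) by (intro; split; incid).
apply has_conjugate_intro.
- destruct (exists_off_fiber f) as (x & ? & ?); auto.
  destruct (third_point f x) as (y & ? & ? & ?); [incid|].
  destruct (middle_conf P0 d f x y) as (a1 & a2 & a3 & a4 & _ & C & _); [auto; incid .. |].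
  exists a1, a2, a3, a4; auto.
- intros. apply (conf_special_meet d D f a1 a2 a3 a4); auto.
- destruct (classic four_fibers) as [F|F].
  + set (ok := fun P => plane P /\ P d /\ P f).
    set (R := fun (P : point S -> Prop) x y h => exists a1 a2 a3 a4, conf d D f a1 a2 a3 a4 /\ P a2 /\
      sp x a2 /\ sp y a1 /\ sp f h /\ collinear a1 a3 h /\
      (x <> D /\ y <> D /\ ~ sp f x /\ ~ sp f y /\ ~ sp x y)).
    assert (K : forall P P' x y x' y' h h', ok P -> ok P' -> R P x y h -> R P' x' y' h' -> h = h').
    { apply (fiber_chain ok f R); auto.
      - intros P (? & ? & ?). apply other_plane; auto.
      - intros P x y (? & ? & ?) ? ? ? ? ?.
        destruct (middle_conf P d f x y) as (a1 & a2 & a3 & a4 & h & ?); auto.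
        exists h, a1, a2, a3, a4. tauto.
      - intros P x y h (a1 & a2 & a3 & a4 & ?). tauto.
      - intros P P' x y x' y' h k (? & ? & ?) (? & ? & ?) ? nx ny
          (a1 & a2 & a3 & a4 & Ca & ? & ? & ? & ? & ? & ? & ? & _)
          (b1 & b2 & b3 & b4 & Cb & ? & ? & ? & ? & ? & ? & ? & _).
        assert (a2 <> D /\ a1 <> D) by (unfold conf in Ca; inc_conj; split; incid).
        assert (b2 <> D /\ b1 <> D) by (unfold conf in Cb; inc_conj; split; incid).
        apply (middle_compare d f a1 a2 a3 a4 b1 b2 b3 b4 P P'); auto;
          clear Ca Cb; incid. }
    assert (W : forall a1 a2 a3 a4 h, conf d D f a1 a2 a3 a4 -> sp f h -> collinear a1 a3 h ->
      exists P, ok P /\ R P a2 a1 h).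
    { intros a1 a2 a3 a4 h C ? ?. pose proof C as C'. unfold conf in C'. inc_conj.
      assert (a2 <> D) by incid. assert (a1 <> D) by incid.
      destruct (span d f a2) as (P & ? & ? & ? & ?); auto.
      exists P. split; [split; auto|]. exists a1, a2, a3, a4.
      repeat split; auto; incid. }
    intros a1 a2 a3 a4 b1 b2 b3 b4 h k Ca Cb Hh ? Hk ?. rewrite Hdf in Hh, Hk.
    destruct (W a1 a2 a3 a4 h) as (P & ? & ?); auto.
    destruct (W b1 b2 b3 b4 k) as (P' & ? & ?); auto.
    apply (K P P' a2 a1 b2 b1); auto.
  + assert (W : forall a1 a2 a3 a4 h, conf d D f a1 a2 a3 a4 -> sp f h ->
      collinear a1 a3 h -> h = D).
    { intros a1 a2 a3 a4 h Ca ? ?. unfold conf in Ca. inc_conj.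
      assert (~ sp f a2) by incid. assert (~ sp f a1) by incid. assert (~ sp a2 a1) by incid.
      assert (a1 <> D) by incid. assert (a2 <> D) by incid. assert (a3 <> D) by incid.
      (* The special lines of f and a2 do not contain a3, so a1 a3 is special and meets the base
         line in D. *)
      destruct (three_fibers f a2 a1 a3) as [|[|]]; [auto; incid .. | | |].
      - exfalso; incid.
      - exfalso; incid.
      - incid. }
    intros a1 a2 a3 a4 b1 b2 b3 b4 h k Ca Cb Hh ? Hk ?. rewrite Hdf in Hh, Hk.
    rewrite (W a1 a2 a3 a4 h), (W b1 b2 b3 b4 k); auto.
Qed.

End ProjectiveRectangle.

(** * Cases by the position of D relative to the base triple *)

Theorem theorem3p2 (S : incidence_structure) (D : point S)
    (HPR : nontrivial_projective_rectangle S D)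
    (d e f : point S) (Hde : d <> e) (Hdf : d <> f) (Hef : e <> f)
    (Hdef : (exists l : line S,
               ordinary_line D l /\ inc d l /\ inc e l /\ inc f l) \/
            (collinear d e f /\ (d = D \/ e = D \/ f = D))) :
  exists h : point S, is_harmonic_conjugate d e f h.
Proof.
destruct HPR as [PR NT]. apply has_conjugate_harmonic.
destruct Hdef as [(l & Hl & ? & ? & ?)|(H & [-> | [-> | ->]])].
- assert (~ collinear D d f).
  { intros (m & ? & ? & ?). apply Hl. rewrite (line_unique d f l m); auto. }
  apply ordinary_conjugate; auto. exists l; auto.
- apply tip_conjugate; auto.
- apply middle_conjugate; auto. incid.
- apply has_conjugate_swap, tip_conjugate; auto; incid.
Qed.
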